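(* Let $\mathbf{a}=(a_n)_{n\ge1}$ be a sequence in $\mathbb{F}_q[T]$ which is not ultimately periodic, with $\deg a_n\ge1$ for all $n\ge1$. Let $\xi:=[0,a_1,a_2,\ldots]$ with convergent denominators $(q_n)$, and assume $(|q_n|^{1/n})_{n\ge1}$ is bounded. Put $m:=\liminf_{n\to\infty}|q_n|^{1/n}$ and $M:=\limsup_{n\to\infty}|q_n|^{1/n}$. Then $w_2(\xi)\ge w_2^*(\xi)\ge\max\left(2,\frac{\log m}{\log M}\mathrm{Dio}(\mathbf{a})-1\right)$; in particular, if $(|q_n|^{1/n})_{n\ge1}$ converges then $w_2(\xi)\ge w_2^*(\xi)\ge\max(2,\mathrm{Dio}(\mathbf{a})-1)$. If moreover $(|a_n|)_{n\ge1}$ is bounded, then $w_2(\xi)\ge\max\left(2,\frac{\log m}{\log M}(\mathrm{Dio}(\mathbf{a})+1)-1\right)$, and in particular, if $(|q_n|^{1/n})_{n\ge1}$ converges then $w_2(\xi)\ge\max(2,\mathrm{Dio}(\mathbf{a}))$.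
   Context: $p$ is a prime, $q$ a power of $p$; $\mathbb{F}_q((T^{-1}))$ is the Laurent series field over $\mathbb{F}_q$ with $|\sum_{n\ge N}a_nT^{-n}|=q^{-N}$ ($a_N\ne0$), extended uniquely to an algebraic closure; $\overline{\mathbb{F}_q(T)}$ is the algebraic closure of $\mathbb{F}_q(T)$ there. For $P\in(\mathbb{F}_q[T])[X]$, $H(P)$ is the maximum absolute value of its coefficients; for $\alpha\in\overline{\mathbb{F}_q(T)}$, $H(\alpha)$, $\deg\alpha$ are the height and degree of its minimal polynomial (the non-constant irreducible primitive polynomial in $(\mathbb{F}_q[T])[X]$ vanishing at $\alpha$ with leading coefficient monic in $T$). $w_2(\xi)$ is the supremum of $w$ such that $0<|P(\xi)|\le H(P)^{-w}$ for infinitely many $P$ of degree $\le2$; $w_2^*(\xi)$ is the supremum of $w^*$ such that $0<|\xi-\alpha|\le H(\alpha)^{-w^*-1}$ for infinitely many $\alpha\in\overline{\mathbb{F}_q(T)}$ with $\deg\alpha\le2$. $[a_0,a_1,\ldots]$ is the continued fraction with convergents $p_n/q_n$: $q_{-1}=0,q_0=1,q_n=a_nq_{n-1}+q_{n-2}$ (similarly $p_n$ with $p_{-1}=1,p_0=a_0$). A sequence is ultimately periodic if it equals $U\overline{V}$ (a finite word followed by infinite repetition of a nonempty word). Words: $|W|$ is length, $W^w=W^{\lfloor w\rfloor}W'$ with $W'$ the prefix of $W$ of length $\lceil (w-\lfloor w\rfloor)|W|\rceil$. $\mathbf{a}$ satisfies Condition $( * )_\rho$ if there are finite words $U_n,V_n$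 and reals $w_n\ge0$ with $U_nV_n^{w_n}$ a prefix of $\mathbf{a}$, $|U_nV_n^{w_n}|/|U_nV_n|\ge\rho$, and $(|V_n^{w_n}|)_n$ strictly increasing; $\mathrm{Dio}(\mathbf{a})\in[1,+\infty]$ is the supremum of such $\rho$ (when it is $+\infty$ the bounds are read as $+\infty$). *)

(* Defs.v *)
From HB Require Import structures.
From mathcomp Require Import all_boot all_order all_algebra all_field.
From mathcomp Require Import all_classical all_reals all_analysis.
From mathcomp Require Import zify.

Set Implicit Arguments.
Unset Strict Implicit.
Unset Printing Implicit Defensive.

Import Order.TTheory GRing.Theory Num.Theory.
Import numFieldNormedType.Exports.

Local Open Scope classical_set_scope.
Local Open Scope ring_scope.

(* [lcoef x n] is the coefficient of T^(-n) (not of T^n), so that only       *)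
(* finitely many negative n carry a nonzero coefficient.                      *)
Definition vanishes_below (F : fieldType) (f : int -> F) (N : int) : Prop :=
  forall n, n < N -> f n = 0.

Record laurent (F : fieldType) := Laurent {
  lcoef :> int -> F;
  _ : `[< exists N, vanishes_below lcoef N >] }.

HB.instance Definition _ (F : fieldType) := [isSub for @lcoef F].
HB.instance Definition _ (F : fieldType) := [Choice of laurent F by <:].

Section LaurentField.
Variable F : fieldType.
Implicit Types (f g h : int -> F) (x y z : laurent F) (N M k : int).

Definition lbounded f := exists N, vanishes_below f N.

Lemma laurentP x : lbounded x.
Proof. by case: x => f /= /asboolP. Qed.

Definition mkLaurent f (bf : lbounded f) : laurent F := Laurent (asboolT bf).

Lemma laurent_eq x y : lcoef x =1 lcoef y -> x = y.
Proof. by move=> xy; apply: val_inj; apply/funext. Qed.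

Lemma vanishes_le f N M : M <= N -> vanishes_below f N -> vanishes_below f M.
Proof. by move=> MN fN n nM; apply: fN; exact: lt_le_trans MN. Qed.

Lemma laurent2P x y : exists N, vanishes_below x N /\ vanishes_below y N.
Proof.
have [N xN] := laurentP x; have [M yM] := laurentP y.
exists (Num.min N M); split; [apply: vanishes_le xN|apply: vanishes_le yM];
  by rewrite ge_min lexx ?orbT.
Qed.

Lemma laurent3P x y z : exists N,
  [/\ vanishes_below x N, vanishes_below y N & vanishes_below z N].
Proof.
have [N [xN yN]] := laurent2P x y; have [M zM] := laurentP z.
exists (Num.min N M); split;
  [apply: vanishes_le xN|apply: vanishes_le yN|apply: vanishes_le zM];
  by rewrite ge_min lexx ?orbT.
Qed.

Lemma lbounded_add x y : lbounded (fun n => x n + y n).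
Proof.
have [N [xN yN]] := laurent2P x y.
by exists N => n nN; rewrite xN// yN// addr0.
Qed.

Lemma lbounded_opp x : lbounded (fun n => - x n).
Proof. by have [N xN] := laurentP x; exists N => n nN; rewrite xN// oppr0. Qed.

Lemma lbounded_zero : lbounded (fun=> 0).
Proof. by exists 0. Qed.

Lemma lbounded_one : lbounded (fun n => (n == 0)%:R).
Proof. by exists 0 => n n0; rewrite lt_eqF. Qed.

Definition ladd x y := mkLaurent (lbounded_add x y).
Definition lopp x := mkLaurent (lbounded_opp x).
Definition lzero := mkLaurent lbounded_zero.
Definition lone := mkLaurent lbounded_one.

Lemma laddA : associative ladd.
Proof. by move=> x y z; apply: laurent_eq => n /=; rewrite addrA. Qed.
Lemma laddC : commutative ladd.
Proof. by move=> x y; apply: laurent_eq => n /=; rewrite addrC. Qed.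
Lemma ladd0 : left_id lzero ladd.
Proof. by move=> x; apply: laurent_eq => n /=; rewrite add0r. Qed.
Lemma laddN : left_inverse lzero lopp ladd.
Proof. by move=> x; apply: laurent_eq => n /=; rewrite addNr. Qed.

HB.instance Definition _ :=
  GRing.isZmodule.Build (laurent F) laddA laddC ladd0 laddN.

Lemma lcoefD x y k : (x + y) k = x k + y k. Proof. by []. Qed.
Lemma lcoefN x k : (- x) k = - x k. Proof. by []. Qed.
Lemma lcoef0 k : (0 : laurent F) k = 0. Proof. by []. Qed.

(* The sum below has finite support as soon as f and g vanish below some     *)
(* bound.                                                                     *)
Definition lconv f g (k : int) : F := \sum_(i \in [set: int]) f i * g (k - i).

Lemma lconvE f g N M k (n : nat) : vanishes_below f N -> vanishes_below g M ->
  k < N + M + n%:Z -> lconv f g k = \sum_(i < n) f (N + i%:Z) * g (k - (N + i%:Z)).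
Proof.
move=> fN gM kn; rewrite /lconv.
rewrite (fsbigE [seq N + i%:Z | i <- iota 0 n]) //=.
- rewrite big_map (eq_bigl xpredT); last by move=> i; rewrite in_setT.
  by rewrite (_ : iota 0 n = index_iota 0 n) ?big_mkord// /index_iota subn0.
- by rewrite map_inj_uniq ?iota_uniq// => i j /addrI [].
- move=> i _ /mapP ni.
  have [iN|Ni] := ltP i N; first by rewrite fN ?mul0r.
  rewrite [g _]gM ?mulr0//; apply: contrapT => kiM; apply: ni.
  exists `|(i - N)%R|%N; last by rewrite gez0_abs; lia.
  by rewrite mem_iota; lia.
Qed.

Lemma lconv_below f g N M : vanishes_below f N -> vanishes_below g M ->
  vanishes_below (lconv f g) (N + M).
Proof.
by move=> fN gM k kNM; rewrite (lconvE (n := 0) fN gM) ?addr0// big_ord0.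
Qed.

Lemma lbounded_mul x y : lbounded (lconv x y).
Proof.
have [N xN] := laurentP x; have [M yM] := laurentP y.
by exists (N + M); exact: lconv_below.
Qed.

Definition lmul x y := mkLaurent (lbounded_mul x y).

(* Truncations to polynomials reduce the ring axioms to those of {poly F}. *)
Definition ltrunc f N (n : nat) : {poly F} := \poly_(i < n) f (N + i%:Z).

Lemma lconv_trunc f g N M (m n : nat) : vanishes_below f N -> vanishes_below g M ->
  (m < n)%N -> lconv f g (N + M + m%:Z) = (ltrunc f N n * ltrunc g M n)`_m.
Proof.
move=> fN gM mn; rewrite (lconvE (n := m.+1) fN gM); last lia.
rewrite coefM; apply: eq_bigr => i _; have := ltn_ord i => im.
rewrite !coef_poly !ifT; [|lia|lia].
by congr (_ * g _); lia.
Qed.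

Lemma lmulC : commutative lmul.
Proof.
move=> x y; apply: laurent_eq => k /=.
have [N [xN yN]] := laurent2P x y.
have [kN|Nk] := ltP k (N + N).
  by rewrite (lconv_below xN yN)// (lconv_below yN xN).
have -> : k = N + N + `|(k - (N + N))%R|%N%:Z by rewrite gez0_abs; lia.
set m := `|_|%N.
by rewrite (lconv_trunc xN yN (ltnSn m)) (lconv_trunc yN xN (ltnSn m)) mulrC.
Qed.

Lemma lmulA : associative lmul.
Proof.
move=> x y z; apply: laurent_eq => k /=.
have [N [xN yN zN]] := laurent3P x y z.
have xyN := lconv_below xN yN; have yzN := lconv_below yN zN.
have [kN|Nk] := ltP k (N + N + N).
  by rewrite (lconv_below xyN zN)// (lconv_below xN yzN)// addrA.
have kE : k = N + N + N + `|(k - (N + N + N))%R|%N%:Z by rewrite gez0_abs; lia.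
rewrite kE; set m := `|_|%N.
rewrite (lconv_trunc xyN zN (ltnSn m)) -addrA -addrA addrA.
rewrite (_ : N + N + (N + m%:Z) = N + (N + N) + m%:Z); last lia.
rewrite (lconv_trunc xN yzN (ltnSn m)) !coefM.
transitivity ((ltrunc x N m.+1 * (ltrunc y N m.+1 * ltrunc z N m.+1))`_m).
  rewrite coefM; apply: eq_bigr => i _; congr (_ * _).
  have im : (m - i < m.+1)%N by lia.
  by rewrite coef_poly im (lconv_trunc yN zN im).
rewrite mulrA coefM; apply: eq_bigr => i _; congr (_ * _).
by have im := ltn_ord i; rewrite coef_poly im (lconv_trunc xN yN im).
Qed.

Lemma lmul1 : left_id lone lmul.
Proof.
move=> x; apply: laurent_eq => k /=.
rewrite /lconv (fsbigE [:: 0 : int])//=.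
- by rewrite big_cons big_nil in_setT addr0 eqxx mul1r subr0.
- by move=> i _; rewrite inE => /negPf ->; rewrite mul0r.
Qed.

Lemma lmulDl : left_distributive lmul +%R.
Proof.
move=> x y z; apply: laurent_eq => k.
have [N [xN yN zN]] := laurent3P x y z.
have xyN : vanishes_below (x + y) N.
  by move=> n nN; rewrite lcoefD xN// yN// addr0.
have kn : k < N + N + `|(k - (N + N))%R|%N.+1%:Z by lia.
rewrite lcoefD /= (lconvE xyN zN kn) (lconvE xN zN kn) (lconvE yN zN kn).
by rewrite -big_split; apply: eq_bigr => i _; exact: mulrDl.
Qed.

Lemma lone_neq0 : lone != 0.
Proof.
apply/eqP => /(congr1 (fun x => lcoef x 0)) /= /eqP.
by rewrite oner_eq0.
Qed.

HB.instance Definition _ := GRing.Zmodule_isComNzRing.Build (laurent F)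
  lmulA lmulC lmul1 lmulDl lone_neq0.

Lemma lcoef1 k : (1 : laurent F) k = (k == 0)%:R. Proof. by []. Qed.
Lemma lcoefM x y k : (x * y) k = lconv x y k. Proof. by []. Qed.

Definition is_lorder x N := x N != 0 /\ vanishes_below x N.

Lemma lorder_ex x : x != 0 -> exists N, is_lorder x N.
Proof.
move=> x0; have [N xN] := laurentP x.
have /existsNP [k xk] : ~ (forall k, x k = 0).
  by move=> x_0; move/eqP: x0; apply; apply: laurent_eq.
have Nk : N <= k by rewrite leNgt; apply/negP => kN; apply: xk; exact: xN.
have ex : exists n, x (N + n%:Z) != 0.
  by exists `|(k - N)%R|%N; apply/eqP; rewrite gez0_abs ?subr_ge0// addrC subrK.
case: (ex_minnP ex) => n xn nmin; exists (N + n%:Z); split=> // j jn.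
have [jN|Nj] := ltP j N; first exact: xN.
apply/eqP/negPn/negP => xj.
have := nmin `|(j - N)%R|%N; rewrite gez0_abs ?subr_ge0// addrC subrK.
by move=> /(_ xj); lia.
Qed.

Fixpoint linv_seq f (N : int) (n : nat) : seq F :=
  if n is m.+1 then
    let s := linv_seq f N m in
    rcons s (- (f N)^-1 * \sum_(i < m.+1) f (N + i.+1%:Z) * s`_(m - i))
  else [:: (f N)^-1].

Lemma size_linv_seq f N n : size (linv_seq f N n) = n.+1.
Proof. by elim: n => //= n ih; rewrite size_rcons ih. Qed.

Lemma nth_linv_seq f N n m : (m <= n)%N ->
  (linv_seq f N n)`_m = (linv_seq f N m)`_m.
Proof.
elim: n => [|n ih]; first by rewrite leqn0 => /eqP ->.
rewrite leq_eqVlt => /predU1P[->//|mn].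
by rewrite [linv_seq f N n.+1]/= nth_rcons size_linv_seq mn ih.
Qed.

Definition linv_fun f N (k : int) : F :=
  if k < - N then 0 else (linv_seq f N `|(k + N)%R|%N)`_(`|(k + N)%R|%N).

Lemma linv_fun_below f N : vanishes_below (linv_fun f N) (- N).
Proof. by move=> k kN; rewrite /linv_fun kN. Qed.

Lemma linv_funE f N (n : nat) : linv_fun f N (- N + n%:Z) = (linv_seq f N n)`_n.
Proof.
rewrite /linv_fun ifF; last by lia.
by have -> : `|(- N + n%:Z + N)%R|%N = n by lia.
Qed.

Lemma lmul_ex x : x != 0 -> exists y, y * x = 1.
Proof.
move=> /lorder_ex [N [xN0 xN]].
have bN := @linv_fun_below x N.
exists (mkLaurent (ex_intro _ _ bN)); rewrite mulrC.
apply: laurent_eq => k; rewrite lcoefM lcoef1 /=.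
have [k0|k0] := ltP k 0.
  by rewrite lt_eqF// (lconv_below xN bN)// subrr.
have -> : k = N + - N + `|k|%N%:Z by lia.
rewrite (lconvE (n := `|k|%N.+1) xN bN); last lia.
case: `|k|%N => [|n].
  rewrite big_ord1 subrr /= !addr0 sub0r.
  by rewrite -[X in linv_fun _ _ X]addr0 (linv_funE _ _ 0) /= divff// eqxx.
rewrite subrr add0r big_ord_recl /= addr0.
have -> : n.+1%:Z - N = - N + n.+1%:Z by lia.
rewrite linv_funE [linv_seq _ _ _]/= nth_rcons size_linv_seq ltnn eqxx.
rewrite mulrA mulrN divff// mulN1r.
apply/eqP; rewrite addrC subr_eq0; apply/eqP; apply: eq_bigr => i _.
rewrite /bump leq0n add1n.
have im := ltn_ord i.
have -> : n.+1%:Z - (N + i.+1%:Z) = - N + (n - i)%N%:Z by lia.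
by rewrite linv_funE -(nth_linv_seq x N (leq_subr i n)).
Qed.

Definition linv x : laurent F := xget 0 [set y | y * x = 1].

Lemma lmulV x : x != 0 -> linv x * x = 1.
Proof. by move=> /lmul_ex [y yx]; rewrite /linv; case: xgetP => // /(_ y). Qed.

Lemma linv0 : linv 0 = 0.
Proof.
rewrite /linv; case: xgetP => // y _ /eqP.
by rewrite mulr0 eq_sym oner_eq0.
Qed.

HB.instance Definition _ := GRing.ComNzRing_isField.Build (laurent F) lmulV linv0.

Lemma absz_geN k (s : nat) : k < - s%:Z -> (s <= `|k|)%N.
Proof. by lia. Qed.

Lemma lpoly_bounded (p : {poly F}) :
  lbounded (fun n : int => if n <= 0 then p`_`|n|%N else 0).
Proof.
exists (- (size p)%:Z) => n np; rewrite ifT; last lia.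
by rewrite nth_default//; exact: absz_geN.
Qed.

Definition lpoly (p : {poly F}) : laurent F := mkLaurent (lpoly_bounded p).

Lemma lpolyE p k : lpoly p k = if k <= 0 then p`_`|k|%N else 0.
Proof. by []. Qed.

Lemma lpoly_is_zmod_morphism : zmod_morphism lpoly.
Proof.
move=> p q; apply: laurent_eq => k; rewrite lcoefD lcoefN !lpolyE.
by case: ifP; rewrite ?coefB ?subr0.
Qed.

HB.instance Definition _ :=
  GRing.isZmodMorphism.Build {poly F} (laurent F) lpoly lpoly_is_zmod_morphism.

Lemma lpoly_is_monoid_morphism : monoid_morphism lpoly.
Proof.
split=> [|p q]; apply: laurent_eq => k.
  rewrite lpolyE lcoef1 coef1 absz_eq0.
  by case: ifP => // k0; case: eqP => // k0'; move: k0; rewrite k0'.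
rewrite lpolyE lcoefM; case: ifPn => k0.
  have kE : k = - `|k|%N%:Z by lia.
  set n := `|k|%N in kE *.
  rewrite /lconv coefM (fsbigE [seq - i%:Z | i <- iota 0 n.+1]).
  - rewrite big_map (eq_bigl xpredT); last by move=> i; rewrite in_setT.
    rewrite (_ : iota 0 n.+1 = index_iota 0 n.+1); last first.
      by rewrite /index_iota subn0.
    rewrite big_mkord; apply: eq_bigr => i _; have im := ltn_ord i.
    rewrite !lpolyE ifT; last lia.
    rewrite ifT; last lia.
    by congr (p`__ * q`__); lia.
  - by rewrite map_inj_uniq ?iota_uniq// => i j /oppr_inj [].
  - by [].
  - move=> i _ /mapP ni; rewrite !lpolyE; case: ifPn => i0; last by rewrite mul0r.
    case: ifPn => ki; last by rewrite mulr0.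
    exfalso; apply: ni; exists `|i|%N; last by lia.
    by rewrite mem_iota; lia.
rewrite /lconv fsbig1// => i _; rewrite !lpolyE.
case: ifPn => i0; last by rewrite mul0r.
by rewrite ifF ?mulr0//; lia.
Qed.

HB.instance Definition _ :=
  GRing.isMonoidMorphism.Build {poly F} (laurent F) lpoly lpoly_is_monoid_morphism.

End LaurentField.

Section RationalFunctions.
Variable F : fieldType.

Lemma lpoly_inj : injective (@lpoly F).
Proof.
move=> p q pq; apply/polyP => i.
have := congr1 (fun x : laurent F => lcoef x (- i%:Z)) pq.
rewrite !lpolyE; case: ifPn => [_|/negP]; last by lia.
by rewrite abszN absz_nat.
Qed.

Lemma lpoly_eq0 (p : {poly F}) : (lpoly p == 0) = (p == 0).
Proof. by rewrite -[0 in LHS](rmorph0 (@lpoly F)) (inj_eq lpoly_inj). Qed.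

Lemma lpolyM : {morph @lpoly F : p q / p * q}. Proof. exact: rmorphM. Qed.
Lemma lpolyD : {morph @lpoly F : p q / p + q}. Proof. exact: rmorphD. Qed.
Lemma lpolyN : {morph @lpoly F : p / - p}. Proof. exact: rmorphN. Qed.

Definition lfrac (x : {fraction {poly F}}) : laurent F :=
  lpoly (repr x).1 / lpoly (repr x).2.

Lemma lfracE (p q : {poly F}) : q != 0 ->
  lfrac (\pi_{fraction {poly F}} (Ratio p q))%qT = lpoly p / lpoly q.
Proof.
move=> q0; rewrite /lfrac.
set r := repr _.
have : (\pi_{fraction {poly F}} r = \pi_{fraction {poly F}} (Ratio p q))%qT.
  by rewrite /r reprK.
move=> /eqmodP; rewrite /= FracField.equivfE !numden_Ratio// => /eqP e.
apply/eqP; rewrite eqr_div ?lpoly_eq0 ?denom_ratioP//.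
by rewrite -!rmorphM e mulrC.
Qed.

Lemma fracP (x : {fraction {poly F}}) : exists p q, q != 0 /\
  x = (\pi_{fraction {poly F}} (Ratio p q))%qT.
Proof.
exists (repr x).1, (repr x).2; split; first exact: denom_ratioP.
by rewrite Ratio_numden reprK.
Qed.

Lemma lfrac_is_zmod_morphism : zmod_morphism lfrac.
Proof.
move=> x y.
have [p [q [q0 ->]]] := fracP x; have [p' [q' [q'0 ->]]] := fracP y.
rewrite -[- _]FracField.pi_opp -[X in lfrac X]FracField.pi_add.
rewrite /FracField.addf /FracField.oppf !numden_Ratio// !lfracE ?mulf_neq0//.
rewrite lpolyD !lpolyM lpolyN.
have := q0; have := q'0; rewrite -!lpoly_eq0 => q'1 q1.
move: (lpoly p) (lpoly q) (lpoly p') (lpoly q') q1 q'1 => A B C D B0 D0.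
by rewrite -mulNr; exact/esym/addf_div.
Qed.

HB.instance Definition _ := GRing.isZmodMorphism.Build
  {fraction {poly F}} (laurent F) lfrac lfrac_is_zmod_morphism.

Lemma lfrac_is_monoid_morphism : monoid_morphism lfrac.
Proof.
split=> [|x y].
  rewrite -tofrac1 /FracField.tofrac; unlock.
  by rewrite lfracE ?oner_neq0// rmorph1 divr1.
have [p [q [q0 ->]]] := fracP x; have [p' [q' [q'0 ->]]] := fracP y.
rewrite -[X in lfrac X]FracField.pi_mul.
rewrite /FracField.mulf !numden_Ratio// !lfracE ?mulf_neq0//.
rewrite !lpolyM.
by move: (lpoly p) (lpoly q) (lpoly p') (lpoly q') => A B C D; exact/esym/mulf_div.
Qed.

HB.instance Definition _ := GRing.isMonoidMorphism.Build
  {fraction {poly F}} (laurent F) lfrac lfrac_is_monoid_morphism.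

End RationalFunctions.

Section AbsoluteValue.
Variable R : realType.

Definition is_absolute_value (E : fieldType) (v : E -> R) : Prop :=
  [/\ forall x, 0 <= v x,
      forall x, v x = 0 <-> x = 0,
      forall x y, v (x * y) = v x * v y
    & forall x y, v (x + y) <= v x + v y].

Variable F : finFieldType.

Definition lorder (x : laurent F) : int := xget 0 [set N | is_lorder x N].

(* |x| = q^(-N) for x = sum_(n >= N) a_n T^(-n) with a_N != 0, where q = #|F| *)
Definition labs (x : laurent F) : R :=
  if x == 0 then 0 else #|F|%:R ^ (- lorder x).

Lemma labsE (x : laurent F) (N : int) :
  is_lorder x N -> labs x = #|F|%:R ^ (- N).
Proof.
move=> [xN0 xN]; rewrite /labs ifF; last first.
  by apply/eqP => x0; rewrite x0 lcoef0 eqxx in xN0.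
congr (_ ^ (- _)); rewrite /lorder; case: xgetP => [M _ [xM0 xM]|/(_ N)[]//].
by apply/eqP; case: ltgtP => // [/xN xM1|/xM xN1];
  rewrite ?xM1 ?xN1 eqxx in xM0 xN0.
Qed.

Definition tabs (p : {poly F}) : R := labs (lpoly p).

Definition poly_height (P : {poly {poly F}}) : R :=
  \big[Num.max/0]_(i < size P) tabs P`_i.

End AbsoluteValue.

Section ContinuedFraction.
Variable F : fieldType.

(* (x_(n-1), x_n) for the recurrence x_n = a_n * x_(n-1) + x_(n-2) *)
Fixpoint cf_rec (a : nat -> {poly F}) (xm1 x0 : {poly F}) (n : nat) :
    {poly F} * {poly F} :=
  if n is m.+1 then
    let: (u, v) := cf_rec a xm1 x0 m in (v, a n * v + u)
  else (xm1, x0).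

Definition cf_num (a : nat -> {poly F}) (n : nat) := (cf_rec a 1 (a 0) n).2.
Definition cf_den (a : nat -> {poly F}) (n : nat) := (cf_rec a 0 1 n).2.

End ContinuedFraction.

Definition is_cf_value (R : realType) (F : finFieldType)
    (a : nat -> {poly F}) (xi : laurent F) : Prop :=
  (fun n => labs R (xi - lpoly (cf_num a n) / lpoly (cf_den a n))) @ \oo
    --> (0 : R).

Section MinimalPolynomial.
Variable F : fieldType.

Definition irreducible_elt (A : idomainType) (x : A) : Prop :=
  [/\ x != 0, x \isn't a GRing.unit
    & forall y z, x = y * z -> y \is a GRing.unit \/ z \is a GRing.unit].

Definition primitive (P : {poly {poly F}}) : Prop :=
  forall d : {poly F}, (forall i, d %| P`_i) -> d \is a GRing.unit.

Variables (Omega : fieldType) (iota : laurent F -> Omega).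

Definition is_minpoly (alpha : Omega) (P : {poly {poly F}}) : Prop :=
  [/\ (1 < size P)%N, irreducible_elt P, primitive P, lead_coef P \is monic
    & root (map_poly (iota \o @lpoly F) P) alpha].

Definition minpoly (alpha : Omega) : {poly {poly F}} :=
  xget 0 [set P | is_minpoly alpha P].

Definition alg_deg (alpha : Omega) : nat := (size (minpoly alpha)).-1.

End MinimalPolynomial.

Definition alg_height (R : realType) (F : finFieldType) (Omega : fieldType)
    (iota : laurent F -> Omega) (alpha : Omega) : R :=
  poly_height R (minpoly iota alpha).

Definition mahler_w (R : realType) (F : finFieldType) (d : nat)
    (xi : laurent F) : \bar R :=
  ereal_sup [set w%:E | w in [set w : R |
    infinite_set [set P : {poly {poly F}} | (size P <= d.+1)%N /\
      0 < labs R (map_poly (@lpoly F) P).[xi] <= poly_height R P `^ (- w)]]].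

Definition koksma_w (R : realType) (F : finFieldType) (Omega : fieldType)
    (iota : laurent F -> Omega) (v : Omega -> R) (d : nat)
    (xi : laurent F) : \bar R :=
  ereal_sup [set w%:E | w in [set w : R |
    infinite_set [set alpha : Omega |
      [/\ algebraicOver (iota \o @lfrac F) alpha,
          (alg_deg iota alpha <= d)%N
        & 0 < v (iota xi - alpha) <= alg_height R iota alpha `^ (- w - 1)]]]].

Section Words.
Variable (A : Type).
Implicit Types (s : nat -> A) (U V W : seq A).

Definition ultimately_periodic s : Prop := exists U V, V <> [::] /\
  forall x0 n, s n = if (n < size U)%N then nth x0 U n
                     else nth x0 V ((n - size U) %% size V).

Definition is_prefix W s : Prop := W = mkseq s (size W).

Variable R : realType.

Definition word_pow W (w : R) : seq A :=
  flatten (nseq `|Num.floor w|%N W) ++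
  take `|Num.ceil ((w - (Num.floor w)%:~R) * (size W)%:R)|%N W.

Definition condition_star s (rho : R) : Prop :=
  exists (U V : nat -> seq A) (w : nat -> R),
    [/\ forall n, 0 <= w n,
        forall n, is_prefix (U n ++ word_pow (V n) (w n)) s,
        forall n, rho <= (size (U n ++ word_pow (V n) (w n)))%:R
                         / (size (U n ++ V n))%:R
      & forall n, (size (word_pow (V n) (w n))
                   < size (word_pow (V n.+1) (w n.+1)))%N].

Definition Dio s : \bar R :=
  ereal_sup [set rho%:E | rho in [set rho : R | condition_star s rho]].

End Words.

(* Main.v *)
(* Write l_n = q_n xi - p_n, so that |l_n| = 1 / |q_(n+1)|.                     *)
(* If a_(r+1) .. a_k has period t - r, then P = l_(r-1) l_t - l_r l_(t-1), seen *)
(* as a quadratic polynomial in xi, changes only its sign when r and t are      *)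
(* shifted along the period. Hence |P(xi)| <= |q_t| / (|q_r| |q_k|^2), while    *)
(* |P'(xi)| = |q_t| / |q_r| and H(P) <= |q_r q_t|. A root alpha of P satisfies  *)
(* |xi - alpha| <= 2 |P(xi)| / |P'(xi)|, and Gauss's lemma bounds its height    *)
(* by H(P); comparing growth rates gives the bounds involving Dio(a).           *)
(* The bound 2 for w_2^* holds for every xi which is not algebraic of degree    *)
(* at most 2 (excluded here by Lagrange's theorem): it is the theorem of        *)
(* Davenport and Schmidt, proved with minimal polynomials in the sense of the   *)
(* geometry of numbers.                                                         *)

Require Import Defs.
From HB Require Import structures.
From mathcomp Require Import all_boot all_order all_algebra all_field.
From mathcomp Require Import all_classical all_reals all_analysis.
From mathcomp Require Import zify ring lra.

Set Implicit Arguments.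
Unset Strict Implicit.
Unset Printing Implicit Defensive.

Import Order.TTheory GRing.Theory Num.Theory.
Import numFieldNormedType.Exports.

Local Open Scope classical_set_scope.
Local Open Scope ring_scope.

(** * Orders of Laurent series and heights of polynomials *)

(** Sizes are integers: [is_lorder x N] means |x| = q^(-N), [vanishes_below x N] means |x| <=
    q^(-N), and [hgt P] is log_q H(P). Write e_n = deg q_n ([cfdeg]). A prefix U V^w with r = |U|, t
    = |UV| and k = |U V^w| >= rho t yields, by [periodic_approximation], a quadratic P with log_q
    H(P) <= e_r + e_t, log_q |P'(xi)| = e_t - e_r and -log_q |P(xi)| >= e_r - e_t + 2 e_k.

    Some root alpha of P is then at distance at most 2 |q_k|^(-2) from xi ([root_near]), and its
    height is at most |q_t|^2, because its minimal polynomial divides P over F[T] ([minpoly_le]).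
    Comparing (w + 1) e_t with e_k gives the Koksma exponent ([koksma_ge_star]). For the Mahler
    exponent one compares (w + 1)(e_r + e_t) with 2 (e_r + e_k), where (rho + 1)(r + t) <= 2 (r + k)
    ([mahler_ge_star]).

    The constant 2 rests on [lagrange]: a nonzero P of degree at most 2 does not vanish at xi.
    Pigeonhole ([small_value_ex]) gives 2 for the Mahler exponent. For the Koksma exponent P'(xi)
    must also not be too small, which [large_derivative] achieves for infinitely many P by an
    infinite descent. Finally, [koksma_le_mahler] compares the exponents: the minimal polynomial of
    a good approximation alpha takes at xi a value of size at most a constant times H(alpha) |xi -
    alpha|. *)

Section Valuation.
Variable F : fieldType.
Implicit Types (x y : laurent F) (N M : int) (p : {poly F}).

Lemma vanishes0 N : vanishes_below (0 : laurent F) N.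
Proof. by []. Qed.

Lemma vanishesD x y N :
  vanishes_below x N -> vanishes_below y N -> vanishes_below (x + y) N.
Proof. by move=> xN yN n nN; rewrite lcoefD xN // yN // addr0. Qed.

Lemma vanishesN x N : vanishes_below x N -> vanishes_below (- x) N.
Proof. by move=> xN n nN; rewrite lcoefN xN // oppr0. Qed.

Lemma vanishesB x y N :
  vanishes_below x N -> vanishes_below y N -> vanishes_below (x - y) N.
Proof. by move=> xN yN; apply: vanishesD => //; exact: vanishesN. Qed.

Lemma vanishesM x y N M K : K <= N + M ->
  vanishes_below x N -> vanishes_below y M -> vanishes_below (x * y) K.
Proof. by move=> KNM xN yM; apply: vanishes_le KNM _; exact: lconv_below. Qed.

Lemma lorder_vanishes x N : is_lorder x N -> vanishes_below x N.
Proof. by case. Qed.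

Lemma lorder_neq0 x N : is_lorder x N -> x != 0.
Proof. by case=> xN _; apply: contraNneq xN => ->; rewrite lcoef0. Qed.

Lemma lorder_uniq x N M : is_lorder x N -> is_lorder x M -> N = M.
Proof.
move=> [xN0 xN] [xM0 xM]; apply/eqP; case: ltgtP => // [/xM|/xN] e.
  by rewrite e eqxx in xN0.
by rewrite e eqxx in xM0.
Qed.

Lemma vanishes_lorder x N M : vanishes_below x N -> is_lorder x M -> N <= M.
Proof.
move=> xN [xM0 _]; rewrite leNgt; apply/negP => /xN e.
by rewrite e eqxx in xM0.
Qed.

Lemma lorderM x y N M :
  is_lorder x N -> is_lorder y M -> is_lorder (x * y) (N + M).
Proof.
move=> [xN0 xN] [yM0 yM]; split; last exact: lconv_below.
rewrite lcoefM (lconvE (n := 1) xN yM); last lia.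
by rewrite big_ord1 addr0 addrAC subrr add0r mulf_neq0.
Qed.

Lemma lorderN x N : is_lorder x N -> is_lorder (- x) N.
Proof.
by move=> [xN0 xN]; split; [rewrite lcoefN oppr_eq0|exact: vanishesN].
Qed.

Lemma lorderDl x y N :
  is_lorder x N -> vanishes_below y (N + 1) -> is_lorder (x + y) N.
Proof.
move=> [xN0 xN] yN; split; first by rewrite lcoefD yN ?addr0//; lia.
by apply: vanishesD => //; apply: vanishes_le yN; lia.
Qed.

Lemma lorderDr x y N :
  is_lorder y N -> vanishes_below x (N + 1) -> is_lorder (x + y) N.
Proof. by rewrite [x + y]addrC; exact: lorderDl. Qed.

Lemma lorder1 : is_lorder (1 : laurent F) 0.
Proof.
by split=> [|n n0]; rewrite lcoef1 ?eqxx ?oner_eq0 // lt_eqF.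
Qed.

Lemma lorderV x N : is_lorder x N -> is_lorder x^-1 (- N).
Proof.
move=> xN; have x0 := lorder_neq0 xN.
have [M xM] : exists M, is_lorder x^-1 M by apply: lorder_ex; rewrite invr_eq0.
suff -> : - N = M by [].
have := lorderM xN xM; rewrite divff // => /(lorder_uniq lorder1).
by move=> /esym/eqP; rewrite addr_eq0 => /eqP ->; rewrite opprK.
Qed.

Lemma lorder_lpoly p : p != 0 -> is_lorder (lpoly p) (- (size p).-1%:Z).
Proof.
move=> p0; split=> [|n nN]; rewrite lpolyE.
  by rewrite ifT ?oppr_le0// abszN absz_nat -lead_coefE lead_coef_eq0.
case: ifP => // n0; rewrite nth_default//; move: p0 nN; rewrite -size_poly_gt0.
by case: (size p) => // s _ /= ns; lia.
Qed.

Lemma vanishes_lpoly p (h : nat) :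
  vanishes_below (lpoly p) (- h%:Z) <-> (size p <= h.+1)%N.
Proof.
have [->|p0] := eqVneq p 0; first by rewrite size_poly0 rmorph0.
have pd := lorder_lpoly p0; have := p0; rewrite -size_poly_gt0 => sp.
split=> [/vanishes_lorder/(_ pd)|sph]; first by lia.
by apply: vanishes_le (lorder_vanishes pd); lia.
Qed.

Lemma lpoly_vanishes1 p : vanishes_below (lpoly p) 1 -> p = 0.
Proof.
move=> p1; apply/eqP/negPn/negP => p0.
by have := vanishes_lorder p1 (lorder_lpoly p0); lia.
Qed.

End Valuation.

Section AbsoluteValueOrder.
Variables (R : realType) (F : finFieldType).
Implicit Types (x y : laurent F) (N M : int) (p : {poly F}).

Local Notation q := (#|F|%:R : R).

Lemma card_field_gt1 : 1 < q.
Proof. by rewrite ltr1n finNzRing_gt1. Qed.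

Lemma card_field_gt0 : 0 < q.
Proof. by rewrite (lt_trans _ card_field_gt1). Qed.

Lemma labs_ge0 x : 0 <= labs R x.
Proof. by rewrite /labs; case: ifP => // _; rewrite exprz_ge0// ler0n. Qed.

Lemma labs0 : labs R (0 : laurent F) = 0.
Proof. by rewrite /labs eqxx. Qed.

Lemma labs_eq0 x : (labs R x == 0) = (x == 0).
Proof.
have [->|x0] := eqVneq x 0; first by rewrite labs0 eqxx.
by rewrite /labs (negPf x0) expfz_eq0 (gt_eqF card_field_gt0) andbF.
Qed.

Lemma labs_gt0 x : (0 < labs R x) = (x != 0).
Proof. by rewrite lt_def labs_ge0 andbT labs_eq0. Qed.

Lemma labs_le x N : labs R x <= q ^ (- N) <-> vanishes_below x N.
Proof.
have [->|x0] := eqVneq x 0; first by rewrite labs0 exprz_ge0// ltW// card_field_gt0.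
have [M xM] := lorder_ex x0; rewrite (labsE R xM).
rewrite ler_eXz2l ?card_field_gt1// lerN2; split=> [NM|/vanishes_lorder]; last exact.
by apply: vanishes_le (lorder_vanishes xM).
Qed.

Lemma labs_lt x N : labs R x < q ^ (- N) -> vanishes_below x (N + 1).
Proof.
have [->|x0] := eqVneq x 0; first by [].
have [M xM] := lorder_ex x0; rewrite (labsE R xM).
rewrite ltr_eXz2l ?card_field_gt1// ltrN2 => NM.
by apply: vanishes_le (lorder_vanishes xM); lia.
Qed.

Lemma tabsE p : p != 0 -> tabs R p = q ^+ (size p).-1.
Proof. by move=> p0; rewrite /tabs (labsE R (lorder_lpoly p0)) opprK. Qed.

Lemma tabs0 : tabs R (0 : {poly F}) = 0.
Proof. by rewrite /tabs rmorph0 labs0. Qed.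

End AbsoluteValueOrder.

(* The height of [P] is [#|F| ^ hgt P]; [swapXY] turns it into a degree. *)
Definition hgt (F : fieldType) (P : {poly {poly F}}) : nat := (sizeY P).-1.

Section Height.
Variable F : fieldType.
Implicit Types (P Q : {poly {poly F}}).

Lemma size_coef_hgt P i : (size (P`_i)%R <= (hgt P).+1)%N.
Proof.
by apply: leq_trans (max_size_coefXY _ _) _; rewrite /hgt; case: (sizeY P).
Qed.

Lemma hgt_le P (h : nat) : (forall i, (size (P`_i)%R <= h.+1)%N) -> (hgt P <= h)%N.
Proof.
move=> Ph; rewrite /hgt; suff : (sizeY P <= h.+1)%N by lia.
by apply/bigmax_leqP => i _; exact: Ph.
Qed.

(** Exact additivity, with no error constant, makes the height of a factor at most that of the
    product. *)
Lemma hgtM P Q : P != 0 -> Q != 0 -> hgt (P * Q) = (hgt P + hgt Q)%N.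
Proof.
move=> P0 Q0; rewrite /hgt !sizeYE rmorphM size_mul ?swapXY_eq0//.
move: P0 Q0; rewrite -(swapXY_eq0 P) -(swapXY_eq0 Q) -!size_poly_gt0.
by case: (size (swapXY P)) => // m; case: (size (swapXY Q)) => // n; rewrite addSn addnS.
Qed.

Lemma hgt_attained P : P != 0 -> exists i, size P`_i = (hgt P).+1.
Proof.
move=> P0; have sP : (0 < #|'I_(size P)|)%N by rewrite card_ord size_poly_gt0.
have [i _ iE] := eq_bigmax_cond (fun i : 'I_(size P) => size P`_i) sP.
exists i; rewrite -[LHS]iE -/(sizeY P) /hgt.
by have : sizeY P != 0%N; [rewrite sizeY_eq0|case: (sizeY P)].
Qed.

End Height.

Lemma poly_heightE (R : realType) (F : finFieldType) (P : {poly {poly F}}) :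
  P != 0 -> poly_height R P = #|F|%:R ^+ hgt P.
Proof.
move=> P0; apply/eqP; rewrite eq_le; apply/andP; split.
  apply: bigmax_le => [|i _]; first by rewrite exprn_ge0.
  have [->|p0] := eqVneq P`_i 0; first by rewrite tabs0 exprn_ge0.
  rewrite tabsE// ler_eXn2l ?card_field_gt1//.
  by rewrite -ltnS prednK ?size_poly_gt0// size_coef_hgt.
have [i iE] := hgt_attained P0.
have iP : (i < size P)%N.
  by rewrite ltnNge; apply/negP => /(nth_default 0) e; rewrite e size_poly0 in iE.
have Pi0 : P`_i != 0 by rewrite -size_poly_gt0 iE.
apply: le_trans (le_bigmax _ _ (Ordinal iP)) => /=.
by rewrite tabsE// iE.
Qed.

(** * Finiteness of polynomials of bounded degree and height, and of roots *)

Section Finiteness.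

Lemma finite_bounded_poly (A : nzRingType) (n : nat) (S : set A) :
  finite_set S -> finite_set [set p : {poly A} | (size p <= n)%N /\ forall i, S p`_i].
Proof.
move=> fS; elim: n => [|n IHn].
  apply: sub_finite_set (finite_set1 0) => p /= [].
  by rewrite leqn0 size_poly_eq0 => /eqP.
pose f (u : A * {poly A}) := u.2 * 'X + u.1%:P.
apply: (sub_finite_set _ (finite_image f (finite_setX fS IHn))).
move=> p /= [sp Sp]; exists (p`_0, \poly_(i < n) p`_i.+1).
  split=> /=; first exact: Sp.
  have [np|pn] := ltnP n (size p).
    split; first exact: size_poly.
    move=> i; rewrite coef_poly; case: ltnP => // ni.
    by have := Sp i.+1; rewrite nth_default//; lia.
  split; first exact: size_poly.
  move=> i; rewrite coef_poly; case: ltnP => // ni.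
  by have := Sp i.+1; rewrite nth_default//; lia.
apply/polyP => i; rewrite /f /= coefD coefMX coefC.
case: i => [|i] /=; first by rewrite add0r.
by rewrite addr0 coef_poly; case: ltnP => // ni; rewrite nth_default//; lia.
Qed.

Lemma finite_bounded_height (F : finFieldType) (d h : nat) :
  finite_set [set P : {poly {poly F}} | (size P <= d)%N /\ (hgt P <= h)%N].
Proof.
have fF : finite_set [set: F] by exact: finite_finset.
apply: sub_finite_set (finite_bounded_poly d (finite_bounded_poly h.+1 fF)).
move=> P /= [Pd Ph]; split=> // i; split=> //.
by apply: leq_trans (size_coef_hgt P i) _; rewrite ltnS.
Qed.

Lemma finite_roots (K : idomainType) (p : {poly K}) :
  p != 0 -> finite_set [set x | root p x].
Proof.
move: {2}(size p) (leqnn (size p)) => n.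
elim: n p => [|n IHn] p; first by rewrite leqn0 size_poly_eq0 => /eqP ->; rewrite eqxx.
move=> sp p0; have [[x px]|nroot] := pselect (exists x, root p x); last first.
  by apply: sub_finite_set (finite_set0 K) => x px; apply: nroot; exists x.
have /factor_theorem[r pE] := px.
have r0 : r != 0 by apply: contraNneq p0 => r0; rewrite pE r0 mul0r.
have sr : (size r <= n)%N.
  by move: sp; rewrite pE size_mul ?polyXsubC_eq0// size_XsubC addn2.
have fU : finite_set ([set y | root r y] `|` [set x]).
  by rewrite finite_setU; split; [exact: IHn|exact: finite_set1].
apply: sub_finite_set fU => y /=; rewrite pE rootM root_XsubC => /orP[ry|/eqP ->].
  by left.
by right.
Qed.

End Finiteness.

(** * Minimal polynomials *)

Section GaussLemma.
Variable F : fieldType.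
Implicit Types (c d : {poly F}) (G S P Q : {poly {poly F}}).

Definition dvd_coefs d P := forall i, d %| P`_i.

Lemma dvd_coefsP d P : dvd_coefs d P <-> exists Q, P = d *: Q.
Proof.
split=> [dP|[Q ->] i]; last by rewrite coefZ dvdp_mulr.
exists (\poly_(i < size P) (P`_i %/ d)); apply/polyP => i.
rewrite coefZ coef_poly; case: ltnP => iP; last by rewrite mulr0 nth_default.
by rewrite mulrC divpK.
Qed.

Lemma dvd_coefsM d P Q : dvd_coefs d P -> dvd_coefs d (P * Q).
Proof. by move=> /dvd_coefsP[P' ->]; apply/dvd_coefsP; exists (P' * Q); rewrite scalerAl. Qed.

Lemma dvd_coefsB d P Q : dvd_coefs d P -> dvd_coefs d Q -> dvd_coefs d (P - Q).
Proof. by move=> dP dQ i; rewrite coefB dvdp_sub. Qed.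

Lemma dvd_coefsD d P Q : dvd_coefs d P -> dvd_coefs d Q -> dvd_coefs d (P + Q).
Proof. by move=> dP dQ i; rewrite coefD dvdp_add. Qed.

Lemma dvd_coefs_monom d c n : d %| c -> dvd_coefs d (c *: 'X^n).
Proof. by move=> dc i; rewrite coefZ dvdp_mulr. Qed.

Lemma dvd_coefs_trans c d P : c %| d -> dvd_coefs d P -> dvd_coefs c P.
Proof. by move=> cd dP i; apply: dvdp_trans cd (dP i). Qed.

Lemma unit_dvdp d c : d \is a GRing.unit -> d %| c.
Proof.
move=> dU; apply: (@dvdp_trans _ 1); last exact: dvd1p.
by rewrite -(mulVr dU) dvdp_mulIr.
Qed.

Lemma size_polyBlead P : P != 0 ->
  (size (P - lead_coef P *: 'X^((size P).-1))%R < size P)%N.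
Proof.
rewrite -size_poly_gt0 => sP; rewrite -[ltnRHS](prednK sP) ltnS.
apply/leq_sizeP => i; rewrite leq_eqVlt coefB coefZ coefXn => /predU1P[<-|iP].
  by rewrite eqxx mulr1 lead_coefE subrr.
by rewrite gtn_eqF// mulr0 subr0 nth_default//; case: (size P) sP iP.
Qed.

Lemma unit_polyE d : (d \is a GRing.unit) = (size d == 1%N).
Proof.
rewrite poly_unitE; apply/andb_idr => /eqP/eqP/size_poly1P[x x0 ->].
by rewrite coefC unitfE.
Qed.

(** Induction on the total size of c, G and S, with d the gcd of c and the leading coefficient of S.
    Removing the leading term of S shows that d divides S. If d is a unit, c divides the leading
    coefficient of G, and the leading term of G can be removed. Otherwise d is cancelled from both c
    and S. *)
Lemma gauss_dvd_coefs c G S : c != 0 ->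
  (forall d, d %| c -> dvd_coefs d G -> d \is a GRing.unit) ->
  dvd_coefs c (G * S) -> dvd_coefs c S.
Proof.
move: {2}(size G + size S + size c)%N (leqnn (size G + size S + size c)%N) => n.
elim: n c G S => [|n IHn] c G S sn c0 coG cGS.
  by move: sn; rewrite leqn0 addn_eq0 => /andP[_]; rewrite size_poly_eq0 (negPf c0).
have decr (x y z x' y' z' : nat) : (x' <= x -> y' < y -> z' <= z ->
  x + y + z <= n.+1 -> x' + y' + z' <= n)%N by lia.
have decr3 (x y z x' : nat) : (x' < x -> x + y + z <= n.+1 -> x' + y + z <= n)%N by lia.
have decr2 (x y z z' : nat) : (z' < z -> x + y + z <= n.+1 -> x + y + z' <= n)%N by lia.
have [->|S0] := eqVneq S 0; first by move=> i; rewrite coef0 dvdp0.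
have [G0|G0] := eqVneq G 0.
  by move=> i; apply/unit_dvdp/coG => // j; rewrite G0 coef0 dvdp0.
pose g := lead_coef G; pose s := lead_coef S.
have cgs : c %| g * s by rewrite /g /s -lead_coefM lead_coefE.
pose d := gcdp c s; have dc : d %| c := dvdp_gcdl _ _.
have ds : d %| s := dvdp_gcdr _ _.
have d0 : d != 0 by rewrite gcdp_eq0 negb_and c0.
have dS : dvd_coefs d S.
  rewrite -[S](subrK (s *: 'X^((size S).-1))).
  apply: dvd_coefsD; last exact: dvd_coefs_monom.
  apply: (IHn d G) => //.
  - exact: decr (leqnn _) (size_polyBlead S0) (dvdp_leq c0 dc) sn.
  - by move=> e ed; apply: coG; exact: dvdp_trans dc.
  - rewrite mulrBr; apply: dvd_coefsB; first exact: dvd_coefs_trans cGS.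
    by rewrite mulrC; apply/dvd_coefsM/dvd_coefs_monom.
have [dU|dNU] := boolP (d \is a GRing.unit).
  have cg : c %| g.
    rewrite -(@Gauss_dvdpl _ g s c) // coprimep_def.
    by rewrite -unit_polyE.
  apply: (IHn c (G - g *: 'X^((size G).-1))) => //.
  - exact: decr3 (size_polyBlead G0) sn.
  - move=> e ec eG; apply: coG => //; rewrite -[G](subrK (g *: 'X^((size G).-1))).
    by apply: dvd_coefsD => //; apply/dvd_coefs_monom/(dvdp_trans ec).
  - rewrite mulrBl; apply: dvd_coefsB => //.
    exact/dvd_coefsM/dvd_coefs_monom.
have /dvd_coefsP[S' SE] := dS; have /divpK cE := dc.
set c1 := c %/ d in cE.
have c10 : c1 != 0 by apply: contraNneq c0 => c10; rewrite -cE c10 mul0r.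
have c1S' : dvd_coefs c1 S'.
  apply: (IHn c1 G) => //.
  - have -> : size S' = size S by rewrite SE size_scale.
    have sd : (1 < size d)%N.
      move: dNU; rewrite unit_polyE -size_poly_gt0 in d0 *.
      by move: d0; case: (size d) => [//|[]].
    apply: decr2 sn => //; rewrite -cE size_mul//.
    by move: sd; case: (size d) => [//|[//|k]] _; rewrite !addnS /= ltnS leq_addr.
  - by move=> e ec1; apply: coG; rewrite -cE dvdp_mulr.
  - move=> i; have := cGS i; rewrite SE -scalerAr coefZ -cE [d * _]mulrC.
    by rewrite dvdp_mul2r.
by move=> i; rewrite SE coefZ -cE mulrC dvdp_mul.
Qed.

End GaussLemma.

Section MinimalPolynomials.
Variables (F : fieldType) (Omega : fieldType) (iota : {rmorphism laurent F -> Omega}).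
Variable alpha : Omega.
Implicit Types (P Q G S : {poly {poly F}}).

Local Notation evp P := (map_poly (iota \o @lpoly F) P).

Lemma lpoly_iota_eq0 (c : {poly F}) : (iota (lpoly c) == 0) = (c == 0).
Proof. by rewrite fmorph_eq0 lpoly_eq0. Qed.

Lemma root_evpZ (c : {poly F}) P : c != 0 ->
  root (evp (c *: P)) alpha = root (evp P) alpha.
Proof. by move=> c0; rewrite map_polyZ rootZ//= lpoly_iota_eq0. Qed.

Lemma root_evpM P Q :
  root (evp (P * Q)) alpha = root (evp P) alpha || root (evp Q) alpha.
Proof. by rewrite rmorphM rootM. Qed.

Lemma root_evp_size P : P != 0 -> root (evp P) alpha -> (1 < size P)%N.
Proof.
move=> P0 rP; rewrite ltnNge; apply/negP => /size1_polyC PE.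
have c0 : P`_0 != 0 by apply: contraNneq P0 => c0; rewrite PE c0.
by move: rP; rewrite PE map_polyC rootC /= lpoly_iota_eq0 (negPf c0).
Qed.

(** Primitive of least degree: this describes the minimal polynomial up to a unit without mentioning
    irreducibility, which is derived from it. *)
Definition minimal_at G := [/\ G != 0, primitive G, root (evp G) alpha
  & forall Q, Q != 0 -> root (evp Q) alpha -> (size G <= size Q)%N].

(** Among the annihilating polynomials of least degree, one of least height is primitive, since
    dividing out a nonconstant content would lower the height. A constant factor then makes the
    leading coefficient monic. *)
Lemma minimal_at_ex P : P != 0 -> root (evp P) alpha ->
  exists G, minimal_at G /\ lead_coef G \is monic.
Proof.
move=> P0 rP.
have ex1 : exists n, `[< exists Q, [/\ Q != 0, root (evp Q) alpha & size Q = n] >].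
  by exists (size P); apply/asboolP; exists P.
case: (ex_minnP ex1) => n /asboolP[Q1 [Q10 rQ1 sQ1]] nmin.
have ex2 : exists h, `[< exists Q, [/\ Q != 0, root (evp Q) alpha, size Q = n & hgt Q = h] >].
  by exists (hgt Q1); apply/asboolP; exists Q1.
case: (ex_minnP ex2) => h /asboolP[G [G0 rG sG hG]] hmin.
have Gprim : primitive G.
  move=> d /dvd_coefsP[G' GE].
  have d0 : d != 0 by apply: contraNneq G0 => d0; rewrite GE d0 scale0r.
  have G'0 : G' != 0 by apply: contraNneq G0 => G'0; rewrite GE G'0 scaler0.
  have sG' : size G' = n by rewrite -sG GE size_scale.
  have rG' : root (evp G') alpha by rewrite -(root_evpZ _ d0) -GE.
  have := hmin (hgt G'); rewrite -hG GE -mul_polyC hgtM ?polyC_eq0//.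
  have /[swap]/[apply] : `[< exists Q, [/\ Q != 0, root (evp Q) alpha,
    size Q = n & hgt Q = hgt G'] >] by apply/asboolP; exists G'.
  rewrite unit_polyE; have : hgt d%:P = (size d).-1.
    rewrite /hgt /sizeY size_polyC d0 /=.
    by rewrite big_ord1 coefC.
  by move=> ->; move: d0; rewrite -size_poly_gt0; case: (size d) => [//|[//|k]] _; lia.
pose u := (lead_coef (lead_coef G))^-1%:P.
have lG0 : lead_coef (lead_coef G) != 0 by rewrite !lead_coef_eq0.
have u0 : u != 0 by rewrite polyC_eq0 invr_eq0.
exists (u *: G); split; last first.
  by rewrite monicE lead_coefZ lead_coefM lead_coefC mulVf.
split.
- by rewrite -mul_polyC; apply: mulf_neq0 => //; rewrite polyC_eq0.
- move=> d duG; apply: Gprim => i; have := duG i; rewrite coefZ.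
  rewrite mul_polyC dvdpZr ?invr_eq0//.
- by rewrite root_evpZ.
- move=> Q Q0 rQ; rewrite size_scale// sG; apply: nmin; apply/asboolP.
  by exists Q.
Qed.

(** Pseudo-division gives c P = Q G, the remainder being zero by minimality of the degree; as G is
    primitive, Gauss's lemma moves the divisor c into Q. *)
Lemma minimal_at_dvd G P : minimal_at G -> root (evp P) alpha ->
  exists S, P = G * S.
Proof.
move=> [G0 Gprim rG Gmin] rP.
pose c := lead_coef G ^+ Pdiv.Idomain.scalp P G.
have c0 : c != 0 by rewrite expf_neq0// lead_coef_eq0.
have PE : c *: P = (P %/ G) * G + P %% G := Pdiv.Idomain.divp_eq P G.
have r0 : P %% G = 0.
  apply/eqP/negPn/negP => r0.
  have := Gmin _ r0; rewrite leqNgt ltn_modpN0// => H; apply/notF/H.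
  have -> : P %% G = c *: P - (P %/ G) * G by rewrite PE addrAC subrr add0r.
  rewrite rmorphB rmorphM /= map_polyZ /= rootE !hornerE.
  by rewrite (rootP rG) (rootP rP) !mulr0 subr0.
rewrite r0 addr0 in PE.
have : dvd_coefs c (P %/ G).
  apply: (@gauss_dvd_coefs _ c G) => //.
    by move=> d _; exact: Gprim.
  by rewrite mulrC -PE; apply/dvd_coefsP; exists P.
move=> /dvd_coefsP[S SE]; exists S.
apply: (@mulfI _ c%:P); first by rewrite polyC_eq0.
by rewrite [LHS]mul_polyC PE SE -mul_polyC -mulrA [S * G]mulrC.
Qed.

(** In a factorization of G one factor vanishes at alpha and so has full degree; the other is a
    constant in X dividing all coefficients of G, hence a unit. *)
Lemma minimal_at_irreducible G : minimal_at G -> irreducible_elt G.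
Proof.
move=> [G0 Gprim rG Gmin]; have sG := root_evp_size G0 rG.
split=> //; first by rewrite poly_unitE negb_and; case: (size G) sG => [|[]].
have key Y Z : G = Y * Z -> root (evp Y) alpha -> Z \is a GRing.unit.
  move=> GE rY.
  have Y0 : Y != 0 by apply: contraNneq G0 => e; rewrite GE e mul0r.
  have Z0 : Z != 0 by apply: contraNneq G0 => e; rewrite GE e mulr0.
  have sYZ : ((size Y + size Z).-1 <= size Y)%N by rewrite -size_mul// -GE Gmin.
  have /size1_polyC ZE : (size Z <= 1)%N.
    move: Y0 sYZ; rewrite -size_poly_gt0.
    by case: (size Y) => // k _; rewrite addSn /= -[in leqRHS]addn1 leq_add2l.
  rewrite poly_unitE ZE; have z0 : Z`_0 != 0.
    by apply: contraNneq Z0 => e; rewrite ZE e.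
  rewrite size_polyC z0 /= coefC /=; apply: Gprim; apply/dvd_coefsP.
  by exists Y; rewrite GE {1}ZE mulrC mul_polyC.
move=> Y Z GE; have := rG; rewrite {1}GE root_evpM => /orP[rY|rZ].
  by right; exact: key GE rY.
by left; apply: key rZ; rewrite mulrC.
Qed.

Lemma minpolyP P : P != 0 -> root (evp P) alpha ->
  is_minpoly iota alpha (minpoly iota alpha).
Proof.
move=> P0 rP; rewrite /minpoly; case: xgetP => // noG.
have [G [Gmin Gmon]] := minimal_at_ex P0 rP; exfalso; apply: (noG G).
have [G0 Gprim rG _] := Gmin; split=> //; first exact: root_evp_size rG.
exact: minimal_at_irreducible.
Qed.

(** An irreducible M is a unit times the primitive G of least degree, so it divides whatever G
    divides. *)
Lemma is_minpoly_dvd M P : is_minpoly iota alpha M -> root (evp P) alpha ->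
  exists S, P = M * S.
Proof.
move=> [sM [M0 _ Mirr] _ _ rM] rP.
have [G [Gmin _]] := minimal_at_ex M0 rM.
have [S ME] := minimal_at_dvd Gmin rM; have [S' ->] := minimal_at_dvd Gmin rP.
have [GU|SU] := Mirr _ _ ME.
  have [_ GNU _] := minimal_at_irreducible Gmin.
  by rewrite GU in GNU.
by exists (S^-1 * S'); rewrite ME -mulrA mulVKr.
Qed.

Lemma minpoly_le P : P != 0 -> root (evp P) alpha ->
  [/\ minpoly iota alpha != 0, (alg_deg iota alpha <= (size P).-1)%N
    & (hgt (minpoly iota alpha) <= hgt P)%N].
Proof.
move=> P0 rP; have Mmin := minpolyP P0 rP; have [_ [M0 _ _] _ _ _] := Mmin.
have [S PE] := is_minpoly_dvd Mmin rP.
have S0 : S != 0 by apply: contraNneq P0 => S0; rewrite PE S0 mulr0.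
split=> //; last by rewrite [in leqRHS]PE hgtM// leq_addr.
rewrite /alg_deg [in leqRHS]PE size_mul//.
by move: S0; rewrite -size_poly_gt0; case: (size S) => // k _; rewrite addnS /= -!subn1 leq_sub2r// leq_addr.
Qed.

End MinimalPolynomials.

(** * Lower bounds for the exponents *)

(** Used to refute finiteness: finitely many approximations have a common bound on their precision,
    which a better approximation then violates. *)
Lemma finite_set_uniform_bound (T : choiceType) (S : set T) (Q : T -> nat -> Prop) :
  finite_set S -> (forall x, S x -> exists n, Q x n) ->
  (forall x m n, (m <= n)%N -> Q x m -> Q x n) ->
  exists N, forall x, S x -> Q x N.
Proof.
move=> /finite_seqP[s ->] SQ Qmono; elim: s SQ => [|y s IHs] SQ.
  by exists 0%N.
have [m ym] := SQ y (mem_head _ _).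
have [|N sN] := IHs; first by move=> x xs; apply: SQ; rewrite /= inE xs orbT.
exists (maxn m N) => x /=; rewrite inE => /predU1P[->|xs].
  by apply: Qmono ym; exact: leq_maxl.
by apply: Qmono (sN _ xs); exact: leq_maxr.
Qed.

Lemma finite_bounded_roots (F : finFieldType) (E : fieldType)
    (f : {rmorphism {poly F} -> E}) (d h : nat) : injective f ->
  finite_set [set x | exists P : {poly {poly F}},
    [/\ P != 0, (size P <= d)%N, (hgt P <= h)%N & root (map_poly f P) x]].
Proof.
move=> f_inj; have := finite_bounded_height F d h => /finite_seqP[s sE].
pose p : {poly E} := \prod_(P <- s | P != 0) map_poly f P.
have p0 : p != 0.
  rewrite /p prodf_seq_neq0; apply/allP => P _; apply/implyP => P0.
  by rewrite map_poly_eq0_id0// -(rmorph0 f) (inj_eq f_inj) lead_coef_eq0.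
apply: sub_finite_set (finite_roots p0) => x /= [P [P0 sP Ph rP]].
have Ps : P \in s by suff : [set` s] P by []; rewrite -sE.
by rewrite /p (big_rem _ Ps) /= P0 rootM rP.
Qed.

Section Evaluation.
Variables (F : fieldType) (xi : laurent F).
Implicit Types P Q : {poly {poly F}}.

Definition leval P : laurent F := (map_poly (@lpoly F) P).[xi].
Definition lderiv P : laurent F := ((map_poly (@lpoly F) P)^`()).[xi].

Lemma leval3 P : (size P <= 3)%N ->
  leval P = lpoly P`_2 * xi ^+ 2 + lpoly P`_1 * xi + lpoly P`_0.
Proof.
move=> sP; rewrite /leval (horner_coef_wide (n := 3)); last first.
  by rewrite (leq_trans (size_poly _ _)).
rewrite !big_ord_recl big_ord0 /= !coef_map /= /bump /=; ring.
Qed.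

Lemma lderiv3 P : (size P <= 3)%N ->
  lderiv P = lpoly P`_2 * xi *+ 2 + lpoly P`_1.
Proof.
move=> sP; rewrite /lderiv (horner_coef_wide (n := 2)); last first.
  apply: leq_trans (size_poly _ _) _.
  by have := leq_trans (size_poly _ _ : (size (map_poly (@lpoly F) P) <= _)%N) sP; case: (size _) => //.
rewrite !big_ord_recl big_ord0 /= !coef_deriv !coef_map /= /bump /=; ring.
Qed.

Lemma levalD P Q : leval (P + Q) = leval P + leval Q.
Proof. by rewrite /leval rmorphD hornerD. Qed.

Lemma levalN P : leval (- P) = - leval P.
Proof. by rewrite /leval rmorphN hornerN. Qed.

Lemma leval_vanishes P N (h : nat) : (size P <= 3)%N -> vanishes_below xi N -> 0 <= N ->
  (hgt P <= h)%N -> vanishes_below (leval P) (- h%:Z).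
Proof.
move=> sP xiN N0 Ph; rewrite leval3//.
have c i : vanishes_below (lpoly P`_i) (- h%:Z).
  by apply/vanishes_lpoly; apply: leq_trans (size_coef_hgt _ _) _; rewrite ltnS.
apply: vanishesD => //; apply: vanishesD.
  apply: (@vanishesM _ _ _ (- h%:Z) (N + N)) => //; first by lia.
  by rewrite expr2; exact: (vanishesM (lexx _) xiN xiN).
by apply: (vanishesM _ (c _) xiN); lia.
Qed.

End Evaluation.

Section ApproximationExponents.
Variables (R : realType) (F : finFieldType) (Omega : closedFieldType).
Variables (iota : {rmorphism laurent F -> Omega}) (v : Omega -> R).
Hypothesis v_abs : is_absolute_value v.
Hypothesis v_ext : forall x : laurent F, v (iota x) = labs R x.
Variable xi : laurent F.
Implicit Types (P Q : {poly {poly F}}) (alpha : Omega).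

Local Notation q := (#|F|%:R : R).
Local Notation evp P := (map_poly (iota \o @lpoly F) P).

Lemma q_ge2 : 2 <= q.
Proof. by rewrite ler_nat finNzRing_gt1. Qed.

Lemma abs_ge0 x : 0 <= v x. Proof. by case: v_abs. Qed.

Lemma absM x y : v (x * y) = v x * v y. Proof. by case: v_abs. Qed.

Lemma absD x y : v (x + y) <= v x + v y. Proof. by case: v_abs. Qed.

Lemma abs_eq0 x : (v x == 0) = (x == 0).
Proof. by case: v_abs => _ v0 _ _; apply/eqP/eqP => /v0. Qed.

Lemma abs_gt0 x : (0 < v x) = (x != 0).
Proof. by rewrite lt_def abs_ge0 andbT abs_eq0. Qed.

Lemma absN x : v (- x) = v x.
Proof.
rewrite -mulN1r absM -(rmorphN1 iota) v_ext.
by rewrite (labsE R (lorderN (lorder1 F))) oppr0 expr0z mul1r.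
Qed.

Lemma labs_powR (x : laurent F) (n : int) :
  is_lorder x n -> labs R x = q `^ (- n%:~R).
Proof. by move=> xn; rewrite (labsE R xn) -powR_intmul ?card_field_gt0// mulrNz. Qed.

Lemma height_powR (h : nat) (y : R) : (q ^+ h) `^ y = q `^ (h%:R * y).
Proof. by rewrite -powR_mulrn ?ler0n// powRrM. Qed.

Lemma card_powRD (x y : R) : q `^ (x + y) = q `^ x * q `^ y.
Proof. by rewrite powRD// (gt_eqF (card_field_gt0 R F)) implybT. Qed.

Lemma card_ler_powR (x y : R) : (q `^ x <= q `^ y) = (x <= y).
Proof.
rewrite /powR gt_eqF ?card_field_gt0// ler_expR ler_pM2r//.
by rewrite ln_gt0// card_field_gt1.
Qed.

Lemma powR_archi (x : R) : 0 < x -> exists N : nat, q `^ (- N%:R) < x.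
Proof.
move=> x0; have [N] : exists N : nat, x^-1 < N%:R.
  by exists (Num.bound x^-1); apply: archi_boundP; rewrite invr_ge0 ltW.
move=> xN; exists N; rewrite powRN powR_mulrn ?ler0n// -[ltRHS]invrK.
rewrite ltf_pV2 ?posrE ?invr_gt0 ?exprn_gt0 ?card_field_gt0//.
by apply: lt_le_trans xN _; rewrite -natrX ler_nat ltnW// ltn_expl// finNzRing_gt1.
Qed.

(** Finitely many nonzero values have bounded order, so solutions of arbitrarily large order are
    infinitely many. *)
Lemma mahler_ge (w : R) :
  (forall N : nat, exists P (n : int), [/\ (size P <= 3)%N, is_lorder (leval xi P) n,
     N%:Z <= n & (hgt P)%:R * w <= n%:~R]) ->
  (w%:E <= mahler_w R 2 xi)%E.
Proof.
move=> Pw; apply: ereal_sup_ubound; exists w => //= Sfin.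
set S := (X in finite_set X) in Sfin.
have [N NS] : exists N : nat, forall P, S P -> forall n, is_lorder (leval xi P) n -> n <= N%:Z.
  apply: (@finite_set_uniform_bound _ S
    (fun P N => forall n, is_lorder (leval xi P) n -> n <= N%:Z)) => //.
    move=> P [_ /andP[+ _]]; rewrite labs_gt0 => /lorder_ex[n Pn].
    by exists `|n|%N => m /(lorder_uniq Pn) <-; lia.
  by move=> P m n mn Pm k /Pm; lia.
have [P [n [sP Pn Nn Pwn]]] := Pw N.+1.
suff /NS/(_ _ Pn) : S P by lia.
split=> //; have P0 : P != 0.
  by apply: contraNneq (lorder_neq0 Pn) => ->; rewrite /leval rmorph0 horner0.
rewrite labs_gt0 (lorder_neq0 Pn) (labs_powR Pn) poly_heightE// height_powR.
by rewrite card_ler_powR mulrN lerN2.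
Qed.

Lemma root_algebraic P alpha : P != 0 -> root (evp P) alpha ->
  algebraicOver (iota \o @lfrac F) alpha.
Proof.
move=> P0 rP; exists (map_poly (@FracField.tofrac _) P).
  by rewrite map_poly_eq0_id0// tofrac_eq0 lead_coef_eq0.
rewrite -map_poly_comp; move: rP; congr (is_true (root _ _)).
apply: eq_map_poly => x /=; congr (iota _).
rewrite /FracField.tofrac; unlock.
by rewrite lfracE ?oner_neq0// rmorph1 divr1.
Qed.

(** With P = A (X - alpha)(X - beta), P'(xi) is A times the sum of xi - alpha and xi - beta. By the
    triangle inequality |P'(xi)| is at most 2 |A| times the distance from xi to the farther root, so
    the nearer root satisfies the bound. A vanishing leading coefficient is treated separately. *)
Lemma root_near P : (size P <= 3)%N -> leval xi P != 0 -> lderiv xi P != 0 ->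
  exists alpha, [/\ root (evp P) alpha, 0 < v (iota xi - alpha)
    & v (iota xi - alpha) * labs R (lderiv xi P) <= 2 * labs R (leval xi P)].
Proof.
move=> sP L0 D0.
pose A := iota (lpoly P`_2); pose B := iota (lpoly P`_1); pose C := iota (lpoly P`_0).
have evE x : (evp P).[x] = A * x ^+ 2 + B * x + C.
  rewrite (horner_coef_wide (n := 3)); last by rewrite (leq_trans (size_poly _ _)).
  rewrite !big_ord_recl big_ord0 /= !coef_map /= /bump /= -/A -/B -/C; ring.
have LE : iota (leval xi P) = A * iota xi ^+ 2 + B * iota xi + C.
  by rewrite leval3// !rmorphD !rmorphM /=.
have DE : iota (lderiv xi P) = A * iota xi *+ 2 + B.
  by rewrite lderiv3// rmorphD rmorphMn rmorphM.
have rootne x : root (evp P) x -> 0 < v (iota xi - x).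
  move=> /rootP; rewrite evE abs_gt0 subr_eq0; apply: contra_eqN => /eqP <-.
  by rewrite -LE fmorph_eq0.
have evP0 : size (evp P) != 1%N.
  apply/negP => /size_poly1P[c c0 PE]; move: D0; rewrite -(fmorph_eq0 iota) DE.
  have Ai i : iota (lpoly P`_i) = (evp P)`_i by rewrite coef_map.
  by rewrite /A /B !Ai PE !coefC /= mul0r mul0rn addr0 eqxx.
have /closed_rootP[alpha ra] := evP0.
rewrite -!v_ext.
have [A0|A0] := eqVneq A 0.
  exists alpha; split=> //; first exact: rootne.
  rewrite DE A0 mul0r mul0rn add0r -absM LE A0 mul0r add0r.
  have := ra; rewrite rootE evE A0 mul0r add0r addr_eq0 => /eqP CE.
  have -> : (iota xi - alpha) * B = B * iota xi + C.
    by rewrite mulrBl [alpha * B]mulrC CE opprK mulrC.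
  by rewrite ler_peMl ?abs_ge0// ler1n.
pose beta := - (B / A) - alpha.
have BE : B = - A * (alpha + beta).
  by rewrite /beta addrC subrK mulNr mulrN opprK mulrCA divff ?mulr1.
have CE : C = A * alpha * beta.
  have := ra; rewrite rootE evE BE => /eqP e.
  apply/eqP; rewrite -subr_eq0 -e; apply/eqP; ring.
have rb : root (evp P) beta by rewrite rootE evE BE CE; apply/eqP; ring.
have LE' : iota (leval xi P) = A * (iota xi - alpha) * (iota xi - beta).
  by rewrite LE BE CE; ring.
have DE' : iota (lderiv xi P) = A * ((iota xi - alpha) + (iota xi - beta)).
  by rewrite DE BE; ring.
have key x y : v (iota xi - x) <= v (iota xi - y) ->
  v (iota xi - x) * (v A * v ((iota xi - x) + (iota xi - y)))
  <= 2 * (v A * v (iota xi - x) * v (iota xi - y)).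
  move=> xy; rewrite mulrA [v _ * v A]mulrC [2 * _]mulrC -[leRHS]mulrA.
  apply: ler_wpM2l; first by rewrite mulr_ge0 ?abs_ge0.
  by apply: le_trans (absD _ _) _; lra.
rewrite LE' DE' !absM.
have [ab|ba] := leP (v (iota xi - alpha)) (v (iota xi - beta)).
  by exists alpha; split; [|exact: rootne|exact: key].
exists beta; split; [by []|exact: rootne|].
by rewrite [(iota xi - alpha) + _]addrC [v A * _ * _]mulrAC; exact/key/ltW.
Qed.

(** The summand 1 in the last condition pays for the factor 2 <= q lost in [root_near]; the height
    of alpha is controlled by that of P through [minpoly_le]. *)
Lemma koksma_ge (w : R) : 0 <= w ->
  (forall N : nat, exists P (n d : int), [/\ (size P <= 3)%N, is_lorder (leval xi P) n,
     is_lorder (lderiv xi P) d, N%:Z <= n - d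
     & (hgt P)%:R * (w + 1) + 1 <= (n - d)%:~R]) ->
  (w%:E <= koksma_w iota v 2 xi)%E.
Proof.
move=> w0 Pw; apply: ereal_sup_ubound; exists w => //= Sfin.
set S := (X in finite_set X) in Sfin.
have [N NS] : exists N : nat, forall x, S x -> q `^ (- N%:R) < v (iota xi - x).
  apply: (@finite_set_uniform_bound _ S
    (fun x N => q `^ (- N%:R) < v (iota xi - x))) => //.
    by move=> x [_ _ /andP[x0 _]]; exact: powR_archi.
  move=> x m n mn; apply: le_lt_trans.
  by rewrite card_ler_powR lerN2 ler_nat.
have [P [n [d [sP Pn Pd Nnd Pw']]]] := Pw N.+1.
have [alpha [ra a0 av]] := root_near sP (lorder_neq0 Pn) (lorder_neq0 Pd).
have P0 : P != 0.
  by apply: contraNneq (lorder_neq0 Pn) => ->; rewrite /leval rmorph0 horner0.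
have [M0 Mdeg Mhgt] := minpoly_le P0 ra.
have {}av : v (iota xi - alpha) <= q `^ (1 - (n - d)%:~R).
  move: av; rewrite (labs_powR Pn) (labs_powR Pd) -ler_pdivlMr ?powR_gt0 ?card_field_gt0//.
  move/le_trans; apply; rewrite -powRN opprK -mulrA -card_powRD.
  rewrite (card_powRD 1) powRr1 ?ler0n// intrB opprB [- _ + _]addrC.
  by apply: ler_wpM2r; [exact: powR_ge0|exact: q_ge2].
suff /NS : S alpha.
  rewrite ltNge => /negP; apply; apply: le_trans av _.
  rewrite card_ler_powR.
have : (N.+1%:Z)%:~R <= (n - d)%:~R :> R by rewrite ler_int.
  by rewrite -[N.+1%:Z%:~R]/(N.+1%:R) -natr1; lra.
split; first exact: root_algebraic ra.
  by apply: leq_trans Mdeg _; case: (size P) sP => [|[|[|[]]]].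
rewrite a0 /=; apply: le_trans av _.
rewrite /alg_height poly_heightE// height_powR.
rewrite card_ler_powR.
have : (hgt (minpoly iota alpha))%:R * (w + 1) <= (hgt P)%:R * (w + 1).
  by apply: ler_wpM2r; [lra|rewrite ler_nat].
lra.
Qed.

End ApproximationExponents.

(** * The Koksma exponent is at most the Mahler exponent *)

Section KoksmaLeMahler.
Variables (R : realType) (F : finFieldType) (Omega : closedFieldType).
Variables (iota : {rmorphism laurent F -> Omega}) (v : Omega -> R).
Hypothesis v_abs : is_absolute_value v.
Hypothesis v_ext : forall x : laurent F, v (iota x) = labs R x.
Variable xi : laurent F.
Implicit Types (P Q : {poly {poly F}}) (alpha : Omega).

Local Notation q := (#|F|%:R : R).
Local Notation evp P := (map_poly (iota \o @lpoly F) P).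

Lemma iota_leval P : iota (leval xi P) = (evp P).[iota xi].
Proof. by rewrite /leval -horner_map -map_poly_comp. Qed.

Lemma lee_from_below (w : R) (x : \bar R) :
  (forall w', w' < w -> (w'%:E <= x)%E) -> (w%:E <= x)%E.
Proof.
move=> wx; case: x wx => [r| |] wx; first 1 last.
- by rewrite leey.
- have := wx (w - 1); rewrite leeNy_eq; apply; lra.
rewrite lee_fin leNgt; apply/negP => rw.
have := wx ((r + w) / 2); rewrite lee_fin => H.
have : (r + w) / 2 <= r by apply: H; lra.
lra.
Qed.

Lemma minpoly_neq0P alpha : minpoly iota alpha != 0 ->
  is_minpoly iota alpha (minpoly iota alpha).
Proof. by rewrite /minpoly; case: xgetP => // _; rewrite eqxx. Qed.

Lemma finite_small_minpoly (h : nat) :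
  finite_set [set alpha | [/\ minpoly iota alpha != 0,
    (alg_deg iota alpha <= 2)%N & (hgt (minpoly iota alpha) <= h)%N]].
Proof.
have lpoly_iota_inj : injective (iota \o @lpoly F).
  exact: inj_comp (fmorph_inj _) (@lpoly_inj F).
apply: sub_finite_set (finite_bounded_roots 3 h lpoly_iota_inj).
move=> alpha /= [M0 Mdeg Mh]; have [_ _ _ _ rM] := minpoly_neq0P M0.
exists (minpoly iota alpha); split=> //; move: Mdeg; rewrite /alg_deg.
by case: (size _) => // k; rewrite ltnS.
Qed.

(** Each such minimal polynomial is also one of xi, hence divides any other of them; all these alpha
    are therefore roots of a single polynomial. *)
Lemma finite_conjugates : finite_set [set alpha |
  minpoly iota alpha != 0 /\ leval xi (minpoly iota alpha) = 0].
Proof.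
set S := (X in finite_set X).
have [[beta [M0 Mxi]]|S0] := pselect (exists beta, S beta); last first.
  by apply: sub_finite_set (finite_set0 _) => alpha Sa; apply: S0; exists alpha.
have [_ [_ _ _] _ _ _] := minpoly_neq0P M0.
have p0 : evp (minpoly iota beta) != 0.
  by rewrite map_poly_eq0_id0// /= lpoly_iota_eq0 lead_coef_eq0.
apply: sub_finite_set (finite_roots p0) => alpha /= [Ma0 Maxi].
have [sMa Mairr Maprim Malead Ma] := minpoly_neq0P Ma0.
have xi_min : is_minpoly iota (iota xi) (minpoly iota alpha).
  by split=> //; rewrite rootE -iota_leval Maxi rmorph0.
have [|T ->] := is_minpoly_dvd xi_min (P := minpoly iota beta).
  by rewrite rootE -iota_leval Mxi rmorph0.
by rewrite root_evpM Ma.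
Qed.

(** Since P(alpha) = 0, P(xi) factors as (xi - alpha)(A (xi + alpha) + B), where A and B are
    coefficients of P. *)
Lemma abs_eval_le P alpha : (size P <= 3)%N -> P != 0 -> root (evp P) alpha ->
  v (iota xi - alpha) <= 1 ->
  labs R (leval xi P) <= (2 * labs R xi + 2) * q ^+ hgt P * v (iota xi - alpha).
Proof.
move=> sP P0 ra va; set A := iota (lpoly P`_2); set B := iota (lpoly P`_1).
have evE x : (evp P).[x] = A * x ^+ 2 + B * x + iota (lpoly P`_0).
  rewrite (horner_coef_wide (n := 3)); last by rewrite (leq_trans (size_poly _ _)).
  rewrite !big_ord_recl big_ord0 /= !coef_map /= /bump /= -/A -/B; ring.
have -> : labs R (leval xi P) = v (iota xi - alpha) * v (A * (iota xi + alpha) + B).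
  rewrite -v_ext -(absM v_abs); congr v; rewrite iota_leval -[LHS]subr0 -(rootP ra) !evE.
  ring.
rewrite mulrC; apply: ler_wpM2r; first exact: abs_ge0.
have c i : v (iota (lpoly P`_i)) <= q ^+ hgt P.
  rewrite v_ext; have /labs_le : vanishes_below (lpoly P`_i) (- (hgt P)%:Z).
    exact/vanishes_lpoly/size_coef_hgt.
  by move=> /(_ R); rewrite opprK.
have alpha_le : v alpha <= labs R xi + 1.
  rewrite -[alpha](subKr (iota xi)) -v_ext.
  by apply: le_trans (absD v_abs _ _) _; rewrite (absN v_abs v_ext) lerD2l.
have sum_le : v (iota xi + alpha) <= 2 * labs R xi + 1.
  by apply: le_trans (absD v_abs _ _) _; rewrite v_ext; lra.
apply: le_trans (absD v_abs _ _) _; rewrite (absM v_abs).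
have : v A * v (iota xi + alpha) <= q ^+ hgt P * (2 * labs R xi + 1).
  by apply: ler_pM; rewrite ?(abs_ge0 v_abs)//; exact: c.
have := c 1%N; rewrite -/B; lra.
Qed.

(** For w > 2, infinitely many alpha remain after discarding those of small height and those whose
    minimal polynomial kills xi. The minimal polynomial of any other alpha satisfies |P(xi)| <= C
    H^(-w), and C is absorbed by any w1 < w. *)
Lemma koksma_le_mahler : (2%:E <= mahler_w R 2 xi)%E ->
  (koksma_w iota v 2 xi <= mahler_w R 2 xi)%E.
Proof.
move=> h2; apply: ub_ereal_sup => _ [w /= Sinf <-].
have [w2|w2] := leP w 2; first by apply: le_trans h2; rewrite lee_fin.
apply: lee_from_below => w' w'w.
have {w'w} : exists2 w1, 2 < w1 < w & w' <= w1.
  exists (Num.max ((2 + w) / 2) ((w' + w) / 2)).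
    by rewrite lt_max gt_max; apply/andP; split; [apply/orP; left|apply/andP; split]; lra.
  by rewrite le_max; apply/orP; right; lra.
case=> w1 /andP[w12 w1w] w'w1; apply: (@le_trans _ _ w1%:E); first by rewrite lee_fin.
apply: mahler_ge => N.
set C := 2 * labs R xi + 2.
have C0 : 0 < C by rewrite /C; have := labs_ge0 R xi; lra.
have lnq : 0 < ln q by rewrite ln_gt0// card_field_gt1.
pose c := ln C / ln q.
have CE : C = q `^ c.
  by rewrite /powR gt_eqF ?card_field_gt0// /c divfK ?gt_eqF// lnK.
(* Above this height C = q^c is at most H^(w - w1), and the order of P(xi) is at least N. *)
pose h := (Num.bound (`|c| / (w - w1)) + N + Num.bound `|c|)%N.
have ww1 : 0 < w - w1 by lra.
have Nb1 : `|c| / (w - w1) < (Num.bound (`|c| / (w - w1)))%:R.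
  by apply: archi_boundP; rewrite divr_ge0// ltW.
have Nb2 : `|c| < (Num.bound `|c|)%:R by exact: archi_boundP.
have finU : finite_set ([set alpha | [/\ minpoly iota alpha != 0,
    (alg_deg iota alpha <= 2)%N & (hgt (minpoly iota alpha) <= h)%N]] `|`
  [set alpha | minpoly iota alpha != 0 /\ leval xi (minpoly iota alpha) = 0]).
  by rewrite finite_setU; split; [exact: finite_small_minpoly|exact: finite_conjugates].
have [alpha [[alg adeg /andP[a0 av]] nU]] := infinite_setN0
  (infinite_setD Sinf finU).
(* The default minimal polynomial 0 would give height 0, and 0 to the nonzero power -w - 1 is 0,
   contradicting the positive distance. *)
have M0 : minpoly iota alpha != 0.
  apply/eqP => M0; move: (lt_le_trans a0 av).
  rewrite /alg_height M0 /poly_height size_poly0 big_ord0 powR0 ?ltxx//.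
  by apply/eqP; lra.
have L0 : leval xi (minpoly iota alpha) != 0.
  by apply/eqP => L0; apply: nU; right.
have hM : (h < hgt (minpoly iota alpha))%N.
  by rewrite ltnNge; apply/negP => Mh; apply: nU; left.
have [sM1 _ _ _ rM] := minpoly_neq0P M0.
set M := minpoly iota alpha in M0 L0 hM sM1 rM *.
have sM : (size M <= 3)%N by move: adeg; rewrite /alg_deg -/M; case: (size M).
have [n Mn] := lorder_ex L0.
set H := hgt M in hM *.
move: av; rewrite /alg_height -/M poly_heightE// height_powR -/H => av.
have H0 : (0 : R) <= H%:R by exact: ler0n.
have Hh : (h%:R : R) + 1 <= H%:R by rewrite natr1 ler_nat.
have av1 : v (iota xi - alpha) <= 1.
  apply: le_trans av _; rewrite -[leRHS](powRr0 q) card_ler_powR.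
  by rewrite mulr_ge0_le0//; lra.
have := abs_eval_le sM M0 rM av1.
rewrite (labs_powR R Mn) -/C CE -powR_mulrn ?ler0n// -card_powRD -/H => le1.
have {}le1 : q `^ (- n%:~R) <= q `^ (c + H%:R + H%:R * (- w - 1)).
  by apply: le_trans le1 _; rewrite (card_powRD _ (c + H%:R)); apply: ler_wpM2l => //; exact: powR_ge0.
rewrite card_ler_powR in le1.
have cc : c <= `|c| by exact: ler_norm.
have hE : h%:R = (Num.bound (`|c| / (w - w1)))%:R + N%:R + (Num.bound `|c|)%:R :> R.
  by rewrite /h !natrD.
have b1 : (0 : R) <= (Num.bound (`|c| / (w - w1)))%:R by exact: ler0n.
have b2 : (0 : R) <= (Num.bound `|c|)%:R by exact: ler0n.
have N0 : (0 : R) <= N%:R by exact: ler0n.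
have key1 : `|c| <= H%:R * (w - w1).
  by rewrite -ler_pdivrMr//; lra.
have Hw : H%:R <= H%:R * (w - 1) by rewrite ler_peMr//; lra.
exists M, n; split=> //; last by rewrite -/H; lra.
rewrite -(ler_int R) -[N%:Z%:~R]/(N%:R); nra.
Qed.

End KoksmaLeMahler.

(** * Continued fractions *)

Section ContinuedFractions.
Variables (R : realType) (F : finFieldType) (a : nat -> {poly F}).
Hypothesis a0 : a 0%N = 0.
Hypothesis a_deg : forall n, (1 <= n)%N -> (1 <= (size (a n)).-1)%N.
Variable xi : laurent F.
Hypothesis xi_cf : is_cf_value R a xi.

(* Indices are shifted by one with respect to the usual convergents:         *)
(* [cfp n / cfq n] is p_(n-1) / q_(n-1), so that the recurrence starts at     *)
(* p_(-1) = 1 and q_(-1) = 0.                                                 *)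
Definition cfq n := (cf_rec a 0 1 n).1.
Definition cfp n := (cf_rec a 1 (a 0) n).1.

(** The degree of q_n in the usual indexing: [cfdeg n] is the degree of [cfq n.+1]. *)
Fixpoint cfdeg n := if n is m.+1 then (cfdeg m + (size (a n)).-1)%N else 0%N.

Definition cfform n : laurent F := lpoly (cfq n) * xi - lpoly (cfp n).

Lemma cf_recS x y n : (cf_rec a x y n.+1).1 = (cf_rec a x y n).2.
Proof. by rewrite /=; case: (cf_rec a x y n). Qed.

Lemma cf_recSS x y n : (cf_rec a x y n.+2).1 =
  a n.+1 * (cf_rec a x y n.+1).1 + (cf_rec a x y n).1.
Proof. by rewrite cf_recS cf_recS /=; case: (cf_rec a x y n). Qed.

Lemma cf_denE n : cf_den a n = cfq n.+1. Proof. by rewrite /cfq cf_recS. Qed.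
Lemma cf_numE n : cf_num a n = cfp n.+1. Proof. by rewrite /cfp cf_recS. Qed.

Lemma cfqSS n : cfq n.+2 = a n.+1 * cfq n.+1 + cfq n.
Proof. exact: cf_recSS. Qed.

Lemma cfpSS n : cfp n.+2 = a n.+1 * cfp n.+1 + cfp n.
Proof. exact: cf_recSS. Qed.

Lemma cfformSS n : cfform n.+2 = lpoly (a n.+1) * cfform n.+1 + cfform n.
Proof. by rewrite /cfform cfqSS cfpSS !lpolyD !lpolyM; ring. Qed.

Lemma cfdeg_ltS n : (cfdeg n < cfdeg n.+1)%N.
Proof. by rewrite /= -[ltnLHS]addn0 ltn_add2l; exact: a_deg. Qed.

Lemma cfdeg_lt m n : (m < n)%N -> (cfdeg m < cfdeg n)%N.
Proof. exact: (homo_ltn ltn_trans cfdeg_ltS). Qed.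

Lemma cfdeg_le m n : (m <= n)%N -> (cfdeg m <= cfdeg n)%N.
Proof. by rewrite leq_eqVlt => /predU1P[->//|/cfdeg_lt/ltnW]. Qed.

Lemma cfdeg_ge n : (n <= cfdeg n)%N.
Proof. by elim: n => // n IHn; apply: leq_ltn_trans IHn (cfdeg_ltS n). Qed.

Lemma size_cfq n : (size (cfq n.+1) = (cfdeg n).+1) /\ (size (cfq n) < size (cfq n.+1))%N.
Proof.
elim: n => [|n [IHs IHn]]; first by rewrite /cfq /= size_poly0 size_poly1.
have an : (1 < size (a n.+1))%N by have := a_deg (ltn0Sn n); case: (size _) => [|[]].
have an0 : a n.+1 != 0 by rewrite -size_poly_gt0 ltnW.
have qn0 : cfq n.+1 != 0 by rewrite -size_poly_gt0 IHs.
have smul : size (a n.+1 * cfq n.+1) = (cfdeg n.+1).+1.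
  rewrite size_mul// IHs /=.
  by move: an; case: (size _) => // k _; rewrite addnS /= addSn addnC.
have lt1 : (size (cfq n) < size (a n.+1 * cfq n.+1)%R)%N.
  by apply: leq_trans IHn _; rewrite smul IHs ltnS ltnW// cfdeg_ltS.
by rewrite cfqSS size_polyDl// smul IHs ltnS cfdeg_ltS.
Qed.

Lemma cfq_neq0 n : cfq n.+1 != 0.
Proof. by rewrite -size_poly_gt0 (size_cfq n).1. Qed.

Lemma lorder_cfq n : is_lorder (lpoly (cfq n.+1)) (- (cfdeg n)%:Z).
Proof. by have := lorder_lpoly (cfq_neq0 n); rewrite (size_cfq n).1. Qed.

Lemma cf_det n : cfp n.+1 * cfq n - cfp n * cfq n.+1 = (-1) ^+ n.+1.
Proof.
elim: n => [|n IHn]; first by rewrite /cfp /cfq /= a0; ring.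
by rewrite cfqSS cfpSS exprS -IHn; ring.
Qed.

Local Notation cv n := (lpoly (cf_num a n) / lpoly (cf_den a n)).

Lemma lorder_cvS n : is_lorder (cv n.+1 - cv n) (cfdeg n + cfdeg n.+1)%:Z.
Proof.
have q0 m : lpoly (cfq m.+1) != 0 by rewrite lpoly_eq0 cfq_neq0.
have -> : cv n.+1 - cv n = lpoly ((-1) ^+ n.+2) * (lpoly (cfq n.+2))^-1 * (lpoly (cfq n.+1))^-1.
  rewrite !cf_denE !cf_numE -cf_det lpolyD lpolyN !lpolyM; field.
  by rewrite !q0.
have -> : (cfdeg n + cfdeg n.+1)%:Z = 0 + - - (cfdeg n.+1)%:Z + - - (cfdeg n)%:Z by lia.
apply: lorderM; last exact/lorderV/lorder_cfq.
apply: lorderM; last exact/lorderV/lorder_cfq.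
rewrite rmorphXn rmorphN1 -signr_odd; case: (odd _); rewrite ?expr1 ?expr0.
  exact/lorderN/lorder1.
exact: lorder1.
Qed.

(** Successive differences of convergents have strictly increasing orders, so in the telescoping sum
    the first one decides. *)
Lemma lorder_cvB n m : (n < m)%N -> is_lorder (cv m - cv n) (cfdeg n + cfdeg n.+1)%:Z.
Proof.
elim: m => // m IHm; rewrite ltnS leq_eqVlt => /predU1P[->|nm]; first exact: lorder_cvS.
have -> : cv m.+1 - cv n = (cv m.+1 - cv m) + (cv m - cv n) by rewrite addrA subrK.
apply: lorderDr; first exact: IHm.
apply: vanishes_le (lorder_vanishes (lorder_cvS m)).
by have := cfdeg_lt nm; have := @cfdeg_le n.+1 m nm; have := cfdeg_ltS m; lia.
Qed.

Lemma lorder_xi_cv n : is_lorder (xi - cv n) (cfdeg n + cfdeg n.+1)%:Z.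
Proof.
set N : int := (_ + _)%:Z.
have qN : 0 < (#|F|%:R : R) ^ (- N) by rewrite exprz_gt0// card_field_gt0.
have := xi_cf => /cvgrPdist_lt/(_ _ qN)[m _ mN].
(* A convergent so close to xi that replacing xi by it does not change the order. *)
have /mN := leq_maxl m n.+1; set k := maxn m n.+1 => /=.
rewrite distrC subr0 ger0_norm ?labs_ge0// => /labs_lt kN.
have -> : xi - cv n = (xi - cv k) + (cv k - cv n) by rewrite addrA subrK.
by apply: lorderDr kN; apply: lorder_cvB; exact: leq_maxr.
Qed.

Lemma lorder_cfform n : is_lorder (cfform n) (cfdeg n)%:Z.
Proof.
case: n => [|n].
  rewrite /cfform /cfq /cfp /= rmorph0 rmorph1 mul0r sub0r.
  exact/lorderN/lorder1.
have -> : cfform n.+1 = lpoly (cfq n.+1) * (xi - cv n).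
  rewrite /cfform cf_denE cf_numE mulrBr mulrCA divff ?mulr1//.
  by rewrite lpoly_eq0 cfq_neq0.
have -> : (cfdeg n.+1)%:Z = - (cfdeg n)%:Z + (cfdeg n + cfdeg n.+1)%:Z by lia.
exact: lorderM (lorder_cfq n) (lorder_xi_cv n).
Qed.

Lemma vanishes_xi : vanishes_below xi 1.
Proof.
have <- : cfform 1 = xi.
  by rewrite /cfform /cfq /cfp /= a0 rmorph0 rmorph1 mul1r subr0.
have := lorder_vanishes (lorder_cfform 1).
by apply: vanishes_le; have := cfdeg_ltS 0; lia.
Qed.

Lemma vanishes_cfq n : vanishes_below (lpoly (cfq n)) (- (cfdeg n.-1)%:Z).
Proof.
case: n => [|n]; first by rewrite (_ : cfq 0 = 0)// rmorph0.
exact: lorder_vanishes (lorder_cfq n).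
Qed.

Lemma vanishes_cfp n : vanishes_below (lpoly (cfp n)) (- (cfdeg n.-1)%:Z).
Proof.
have -> : lpoly (cfp n) = lpoly (cfq n) * xi - cfform n by rewrite /cfform; ring.
apply: vanishesB; first by apply: (vanishesM _ (@vanishes_cfq n) vanishes_xi); lia.
by apply: vanishes_le (lorder_vanishes (lorder_cfform n)); lia.
Qed.

Definition quad (x y z : {poly F}) : {poly {poly F}} := Poly [:: z; y; x].

Lemma size_quad x y z : (size (quad x y z) <= 3)%N.
Proof. exact: size_Poly. Qed.

Lemma leval_quad (x y z : {poly F}) (w : laurent F) :
  leval w (quad x y z) = lpoly x * w ^+ 2 + lpoly y * w + lpoly z.
Proof. by rewrite leval3 ?size_quad// !coef_Poly. Qed.

Lemma hgt_quad x y z (h : nat) : vanishes_below (lpoly x) (- h%:Z) ->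
  vanishes_below (lpoly y) (- h%:Z) -> vanishes_below (lpoly z) (- h%:Z) ->
  (hgt (quad x y z) <= h)%N.
Proof.
move=> /vanishes_lpoly xh /vanishes_lpoly yh /vanishes_lpoly zh.
by apply: hgt_le => -[|[|[|i]]]; rewrite coef_Poly //= nth_nil size_poly0.
Qed.

(** The complete quotient [a_(n+1), a_(n+2), ...]; for n = 0 it is 1 / xi. *)
Definition ratio n := - cfform n / cfform n.+1.

Lemma cfform_neq0 n : cfform n != 0.
Proof. exact: lorder_neq0 (lorder_cfform n). Qed.

(** The complete quotient is a_(n+1) plus an element of absolute value less than 1, so it determines
    its polynomial part a_(n+1) and hence the next complete quotient. *)
Lemma ratio_eq i j : ratio i = ratio j -> a i.+1 = a j.+1 /\ ratio i.+1 = ratio j.+1.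
Proof.
have ratioE n : ratio n = lpoly (a n.+1) + (ratio n.+1)^-1.
  rewrite /ratio invf_div invrN mulrN cfformSS mulrDl mulfK ?cfform_neq0//.
  by rewrite mulNr; ring.
have ratioV n : vanishes_below (ratio n.+1)^-1%R 1.
  have : is_lorder (ratio n.+1)^-1 (- ((cfdeg n.+1)%:Z + - (cfdeg n.+2)%:Z)).
    apply/lorderV/lorderM; last exact/lorderV/lorder_cfform.
    exact/lorderN/lorder_cfform.
  by move/lorder_vanishes; apply: vanishes_le; have := cfdeg_ltS n.+1; lia.
move=> ij; have aij : a i.+1 = a j.+1.
  apply/eqP; rewrite -subr_eq0; apply/eqP/lpoly_vanishes1.
  have -> : lpoly (a i.+1 - a j.+1) = (ratio j.+1)^-1 - (ratio i.+1)^-1.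
    rewrite lpolyD lpolyN; apply/eqP; rewrite subr_eq addrAC eq_sym subr_eq.
    by rewrite addrC -ratioE -ij ratioE addrC.
  exact: vanishesB.
split=> //; apply: invr_inj; apply: (addrI (lpoly (a i.+1))).
by rewrite -ratioE ij ratioE aij.
Qed.

(** * Lagrange's theorem: quadratic elements have ultimately periodic expansions *)

Section Lagrange.
Variables x y z : {poly F}.
Hypothesis xyz0 : quad x y z != 0.
Hypothesis xyz_root : leval xi (quad x y z) = 0.

(* The form x X^2 + y X Y + z Y^2 in the basis of two consecutive convergents. *)
Definition form_at n : {poly {poly F}} :=
  let Phi s t := x * s ^+ 2 + y * s * t + z * t ^+ 2 in
  quad (Phi (cfp n.+1) (cfq n.+1))
    (x * cfp n.+1 * cfp n *+ 2 + y * (cfp n.+1 * cfq n + cfp n * cfq n.+1)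
     + z * cfq n.+1 * cfq n *+ 2)
    (Phi (cfp n) (cfq n)).

(** The change of basis has determinant 1 or -1, so x, y, z are recovered as combinations of the new
    coefficients. *)
Lemma form_at_neq0 n : form_at n != 0.
Proof.
apply/eqP => f0.
have c i : (form_at n)`_i = 0 by rewrite f0 coef0.
have := c 0%N; have := c 1%N; have := c 2%N; rewrite /form_at /quad !coef_Poly /=.
set p := cfp n.+1; set p' := cfp n; set q := cfq n.+1; set q' := cfq n.
set A := (X in X = 0 -> _); move=> A0; set B := (X in X = 0 -> _); move=> B0.
set C := (X in X = 0 -> _) => C0.
have det1 : (p * q' - p' * q) ^+ 2 = 1 by rewrite cf_det sqrr_sign.
have x0 : x = 0.
  rewrite -[x]mulr1 -det1; transitivity (q' ^+ 2 * A - q * q' * B + q ^+ 2 * C).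
    by rewrite /A /B /C; ring.
  by rewrite A0 B0 C0; ring.
have y0 : y = 0.
  rewrite -[y]mulr1 -det1.
  transitivity (- (p' * q' * A) *+ 2 + (p * q' + p' * q) * B - (p * q * C) *+ 2).
    by rewrite /A /B /C; ring.
  by rewrite A0 B0 C0; ring.
have z0 : z = 0.
  rewrite -[z]mulr1 -det1; transitivity (p' ^+ 2 * A - p * p' * B + p ^+ 2 * C).
    by rewrite /A /B /C; ring.
  by rewrite A0 B0 C0; ring.
move/eqP: xyz0; apply; apply/polyP => i; rewrite x0 y0 z0 coef_Poly coef0.
by case: i => [|[|[|i]]] //=; rewrite nth_nil.
Qed.

Lemma form_at_root n : leval (ratio n) (form_at n) = 0.
Proof.
have := xyz_root; rewrite !leval_quad => root0.
have l0 := cfform_neq0 n.+1.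
have rE : ratio n * cfform n.+1 + cfform n = 0 by rewrite /ratio divfK// addNr.
have pE m : lpoly (cfp m) = lpoly (cfq m) * xi - cfform m by rewrite /cfform; ring.
rewrite !(lpolyD, lpolyM) !pE.
set q := lpoly (cfq n.+1); set q' := lpoly (cfq n).
set l := cfform n.+1 in rE *; set l' := cfform n in rE *; set r := ratio n in rE *.
transitivity ((q * r + q') ^+ 2 * (lpoly x * xi ^+ 2 + lpoly y * xi + lpoly z)
  - (r * l + l') * (q * r + q') * (lpoly x * xi *+ 2 + lpoly y)
  + lpoly x * (r * l + l') ^+ 2); first by ring.
by rewrite rE root0; ring.
Qed.

(** Substitute p = q xi - l. The terms quadratic in the q's cancel because xi is a root; what
    remains is the derivative at xi times products q l, plus x times products l l, and all these
    products have absolute value at most 1. *)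
Lemma hgt_form_at n : (hgt (form_at n) <= hgt (quad x y z))%N.
Proof.
pose h := hgt (quad x y z); rewrite -/h.
have := xyz_root; rewrite leval_quad => root0.
pose D := lpoly x * xi *+ 2 + lpoly y.
have c i : vanishes_below (lpoly (quad x y z)`_i) (- h%:Z).
  exact/vanishes_lpoly/size_coef_hgt.
have xh : vanishes_below (lpoly x) (- h%:Z) by have := c 2%N; rewrite coef_Poly.
have Dh : vanishes_below D (- h%:Z).
  apply: vanishesD; last by have := c 1%N; rewrite coef_Poly.
  have xxi : vanishes_below (lpoly x * xi) (- h%:Z) by apply: (vanishesM _ xh vanishes_xi); lia.
  by rewrite mulr2n; exact: vanishesD.
have pE m : lpoly (cfp m) = lpoly (cfq m) * xi - cfform m by rewrite /cfform; ring.
have lv m := lorder_vanishes (lorder_cfform m).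
have ql m k : (m <= k.+1)%N -> vanishes_below (lpoly (cfq m) * cfform k) 0.
  by move=> mk; apply: (vanishesM _ (@vanishes_cfq m) (lv k));
     have := @cfdeg_le m.-1 k; rewrite -subn1 leq_subLR add1n => /(_ mk); lia.
have ll m k : vanishes_below (cfform m * cfform k) 0.
  by apply: (vanishesM _ (lv m) (lv k)); lia.
have hD (u : laurent F) : vanishes_below u 0 -> vanishes_below (u * D) (- h%:Z).
  by move=> u0; apply: (vanishesM _ u0 Dh); lia.
have hx (u : laurent F) : vanishes_below u 0 -> vanishes_below (lpoly x * u) (- h%:Z).
  by move=> u0; apply: (vanishesM _ xh u0); lia.
have Phih m : vanishes_below
    (lpoly (x * cfp m ^+ 2 + y * cfp m * cfq m + z * cfq m ^+ 2)) (- h%:Z).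
  rewrite !(lpolyD, lpolyM) !pE.
  set q := lpoly (cfq m); set l := cfform m.
  have -> : lpoly x * (q * xi - l) ^+ 2 + lpoly y * (q * xi - l) * q + lpoly z * q ^+ 2
     = - (q * l * D) + lpoly x * (l * l).
    transitivity (q ^+ 2 * (lpoly x * xi ^+ 2 + lpoly y * xi + lpoly z)
      - q * l * D + lpoly x * (l * l)); first by rewrite /D; ring.
    by rewrite root0 mulr0 add0r.
  by apply: vanishesD; [apply/vanishesN/hD/ql|exact/hx/ll].
apply: hgt_quad => //.
rewrite !(lpolyD, lpolyM) !pE.
set q := lpoly (cfq n.+1); set q' := lpoly (cfq n).
set l := cfform n.+1; set l' := cfform n.
match goal with |- vanishes_below (lcoef ?w) _ => have -> : w =
  - ((q * l' + q' * l) * D) + lpoly x * (l * l' + l * l') end.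
  transitivity (q * q' * (lpoly x * xi ^+ 2 + lpoly y * xi + lpoly z) *+ 2
     - (q * l' + q' * l) * D + lpoly x * (l * l' + l * l')); first by rewrite /D; ring.
  by rewrite root0 mulr0 mul0rn add0r.
apply: vanishesD; first by apply/vanishesN/hD/vanishesD; apply: ql; lia.
by apply/hx/vanishesD; exact: ll.
Qed.

Lemma ultimately_periodic_ratio i j : (i < j)%N -> ratio i = ratio j ->
  ultimately_periodic (fun n => a n.+1).
Proof.
move=> ij rij.
have rt t : ratio (i + t) = ratio (j + t).
  by elim: t => [|t IHt]; rewrite ?addn0// !addnS; exact: (ratio_eq IHt).2.
have per t : a (i + t).+1 = a (i + t %% (j - i)).+1.
  elim/ltn_ind: t => t IHt; have [tj|jt] := ltnP t (j - i); first by rewrite modn_small.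
  have -> : (i + t = j + (t - (j - i)))%N by lia.
  rewrite -(ratio_eq (rt _)).1 IHt; last by lia.
  by congr (a (_ + _).+1); rewrite -[in RHS](subnK jt) modnDr.
exists (mkseq (fun n => a n.+1) i), (mkseq (fun n => a (i + n).+1) (j - i)); split.
  by move=> /(congr1 size); rewrite size_mkseq /=; lia.
move=> x0 n; rewrite !size_mkseq; case: ltnP => ni; first by rewrite nth_mkseq.
rewrite nth_mkseq ?ltn_mod ?subn_gt0// -per.
by rewrite subnKC.
Qed.

(** All complete quotients are roots of nonzero quadratic polynomials of bounded height, hence lie
    in a finite set; two of them coincide. *)
Lemma lagrange : ultimately_periodic (fun n => a n.+1).
Proof.
have := finite_bounded_roots 3 (hgt (quad x y z)) (@lpoly_inj F) => /finite_seqP[s sE].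
have rs n : ratio n \in s.
  suff : [set` s] (ratio n) by [].
  rewrite -sE; exists (form_at n); split.
  - exact: form_at_neq0.
  - exact: size_quad.
  - exact: hgt_form_at.
  - by rewrite rootE; apply/eqP; exact: form_at_root.
pose t := mkseq ratio (size s).+1.
have /(uniqPn 0)[i [j [ij]]] : ~~ uniq t.
  apply/negP => /uniq_leq_size H.
  have : (size t <= size s)%N by apply: H => _ /mapP[n _ ->].
  by rewrite size_mkseq ltnn.
rewrite size_mkseq => js; rewrite !nth_mkseq//; last exact: ltn_trans js.
exact: ultimately_periodic_ratio.
Qed.

End Lagrange.

Hypothesis a_aper : ~ ultimately_periodic (fun n => a n.+1).

Lemma leval_neq0 (P : {poly {poly F}}) : (size P <= 3)%N -> P != 0 -> leval xi P != 0.
Proof.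
move=> sP P0; apply/eqP => Pxi; apply: a_aper.
have PE : P = quad P`_2 P`_1 P`_0.
  apply/polyP => i; rewrite coef_Poly; case: i => [|[|[|i]]] //=.
  by rewrite nth_nil nth_default// (leq_trans sP).
by rewrite PE in P0 Pxi; exact: lagrange P0 Pxi.
Qed.

(* If a_(r+1) .. a_(r+j) = a_(t+1) .. a_(t+j) with r < t, the quadratic number *)
(* with preperiod a_1 .. a_r and period a_(r+1) .. a_t is a root of the        *)
(* polynomial below.                                                          *)
Lemma periodic_approximation r t j : (r < t)%N ->
  (forall i, (i < j)%N -> a (r + i).+1 = a (t + i).+1) ->
  exists (P : {poly {poly F}}) (n : int), [/\ (size P <= 3)%N,
    is_lorder (leval xi P) n, is_lorder (lderiv xi P) ((cfdeg r)%:Z - (cfdeg t)%:Z),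
    (hgt P <= cfdeg r + cfdeg t)%N
    & (cfdeg r)%:Z - (cfdeg t)%:Z + 2 * (cfdeg (t + j))%:Z <= n].
Proof.
move=> rt agree.
pose A := cfq r * cfq t.+1 - cfq r.+1 * cfq t.
pose B := - (cfq r * cfp t.+1 + cfp r * cfq t.+1) + (cfq r.+1 * cfp t + cfp r.+1 * cfq t).
pose C := cfp r * cfp t.+1 - cfp r.+1 * cfp t.
pose P := quad A B C.
pose W i := cfform (r + i) * cfform (t + i).+1 - cfform (r + i).+1 * cfform (t + i).
have LE : leval xi P = W 0%N.
  rewrite leval_quad /W !addn0 /cfform /A /B /C.
  by rewrite !(lpolyD, lpolyN, lpolyM); ring.
have DE : lderiv xi P = cfform r * lpoly (cfq t.+1) + (lpoly (cfq r) * cfform t.+1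
    - (lpoly (cfq r.+1) * cfform t + cfform r.+1 * lpoly (cfq t))).
  rewrite lderiv3 ?size_quad// !coef_Poly /= /cfform /A /B.
  by rewrite !(lpolyD, lpolyN, lpolyM); ring.
have lv m := lorder_vanishes (lorder_cfform m).
have rt' := cfdeg_lt rt; have r1t := cfdeg_le rt.
have rS := cfdeg_ltS r; have tS := cfdeg_ltS t.
have rp : (cfdeg r.-1 <= cfdeg r)%N by apply: cfdeg_le; exact: leq_pred.
have tp : (cfdeg t.-1 < cfdeg t)%N by apply: cfdeg_lt; case: (t) rt.
(* Of the four products in P'(xi), [cfform r * lpoly (cfq t.+1)] strictly dominates the others. *)
have DP : is_lorder (lderiv xi P) ((cfdeg r)%:Z - (cfdeg t)%:Z).
  rewrite DE; apply: lorderDl; first exact: lorderM (lorder_cfform _) (lorder_cfq _).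
  apply: vanishesB; first by apply: (vanishesM _ (@vanishes_cfq r) (lv t.+1)); lia.
  apply: vanishesD; first by apply: (vanishesM _ (@vanishes_cfq r.+1) (lv t)) => /=; lia.
  by apply: (vanishesM _ (lv r.+1) (@vanishes_cfq t)); lia.
have P0 : P != 0.
  by apply: contraNneq (lorder_neq0 DP) => ->; rewrite /lderiv rmorph0 deriv0 horner0.
have [n Pn] := lorder_ex (leval_neq0 (size_quad _ _ _) P0).
(* Both pairs of linear forms advance with the same partial quotient, so this two by two determinant
   only changes sign. *)
have Wj i : (i <= j)%N -> W 0%N = (-1) ^+ i * W i.
  elim: i => [|i IHi] ij; first by rewrite expr0 mul1r.
  rewrite IHi ?(ltnW ij)// exprS /W !addnS !cfformSS -(agree i ij); ring.
have dj i : (i <= j)%N -> (cfdeg (r + i) + cfdeg t = cfdeg r + cfdeg (t + i))%N.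
  elim: i => [|i IHi] ij; first by rewrite !addn0.
  by rewrite !addnS /= -(agree i ij); have := IHi (ltnW ij); lia.
exists P, n; split=> //; first exact: size_quad.
- apply: hgt_quad; rewrite !(lpolyD, lpolyN, lpolyM).
  + apply: vanishesB; first by apply: (vanishesM _ (@vanishes_cfq r) (@vanishes_cfq t.+1)) => /=; lia.
    by apply: (vanishesM _ (@vanishes_cfq r.+1) (@vanishes_cfq t)) => /=; lia.
  + apply: vanishesD; [apply: vanishesN|]; apply: vanishesD.
    * by apply: (vanishesM _ (@vanishes_cfq r) (@vanishes_cfp t.+1)) => /=; lia.
    * by apply: (vanishesM _ (@vanishes_cfp r) (@vanishes_cfq t.+1)) => /=; lia.
    * by apply: (vanishesM _ (@vanishes_cfq r.+1) (@vanishes_cfp t)) => /=; lia.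
    * by apply: (vanishesM _ (@vanishes_cfp r.+1) (@vanishes_cfq t)) => /=; lia.
  + apply: vanishesB; first by apply: (vanishesM _ (@vanishes_cfp r) (@vanishes_cfp t.+1)) => /=; lia.
    by apply: (vanishesM _ (@vanishes_cfp r.+1) (@vanishes_cfp t)) => /=; lia.
- apply: vanishes_lorder Pn; rewrite LE (Wj j (leqnn j)).
  have sgn : vanishes_below ((-1) ^+ j : laurent F) 0.
    rewrite -signr_odd; case: (odd j); first exact/vanishesN/lorder_vanishes/lorder1.
    exact/lorder_vanishes/lorder1.
  have := dj j (leqnn j); have := cfdeg_ltS (r + j); have := cfdeg_ltS (t + j) => d1 d2 d3.
  apply: (@vanishesM _ _ _ 0 ((cfdeg r)%:Z - (cfdeg t)%:Z + 2 * (cfdeg (t + j))%:Z)) => //.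
    by rewrite add0r.
  apply: vanishesB; first by apply: (vanishesM _ (lv (r + j)%N) (lv (t + j).+1)); lia.
  by apply: (vanishesM _ (lv (r + j).+1) (lv (t + j)%N)); lia.
Qed.

End ContinuedFractions.

(** * The theorem of Davenport and Schmidt *)

Section Minkowski.
Variables (F : finFieldType) (xi : laurent F).
Hypothesis xi1 : vanishes_below xi 1.

(** Pigeonhole: there are q^(3h+3) polynomials of degree at most 2 and height at most q^h, and only
    3h + 2 coefficients of the value, at positions -h to 2h + 1, to be matched. The difference of
    two polynomials that agree there has the required value. *)
Lemma small_value_ex (h : nat) : exists P : {poly {poly F}},
  [/\ P != 0, (size P <= 3)%N, (hgt P <= h)%N
    & vanishes_below (leval xi P) (2 * h%:Z + 2)].
Proof.
pose V := {ffun 'I_3 * 'I_h.+1 -> F}.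
pose c (u : V) (i : nat) : {poly F} :=
  \poly_(j < h.+1) u (inord i, inord j).
pose PV (u : V) : {poly {poly F}} := \poly_(i < 3) c u i.
pose f (u : V) : {ffun 'I_(3 * h + 2) -> F} :=
  [ffun k : 'I_(3 * h + 2) => leval xi (PV u) ((k : nat)%:Z - h%:Z)].
have PV_inj : injective PV.
  move=> u u' uu; apply/ffunP => -[i j].
  have := congr1 (fun P : {poly {poly F}} => P`_i`_j) uu.
  by rewrite !coef_poly !ltn_ord /= !coef_poly !ltn_ord !inord_val.
have fNinj : ~ injective f.
  move=> /leq_card; rewrite !card_ffun card_prod !card_ord.
  by rewrite leq_exp2l ?finNzRing_gt1//; lia.
have [u [u' [uu fu]]] : exists u u', u <> u' /\ f u = f u'.
  apply: contrapT => H; apply: fNinj => u u' fu; apply: contrapT => uu.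
  by apply: H; exists u, u'.
have sPV w : (size (PV w) <= 3)%N by exact: size_poly.
have hPV w i : (size ((PV w)`_i)%R <= h.+1)%N.
  rewrite coef_poly; case: ifP => _; last by rewrite size_poly0.
  exact: size_poly.
exists (PV u - PV u').
have sP : (size (PV u - PV u')%R <= 3)%N.
  by rewrite (leq_trans (size_polyD _ _))// size_polyN geq_max !sPV.
have hP : (hgt (PV u - PV u')%R <= h)%N.
  apply: hgt_le => i; rewrite coefB (leq_trans (size_polyD _ _))//.
  by rewrite size_polyN geq_max !hPV.
split=> //; first by rewrite subr_eq0; apply/eqP => /PV_inj.
have low := leval_vanishes sP xi1 ler01 hP.
move=> n nh; have [/low//|hn] := ltP n (- h%:Z).
have kP : (`|(n + h%:Z)%R| < 3 * h + 2)%N by lia.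
have := congr1 (fun g : {ffun _ -> F} => g (Ordinal kP)) fu.
rewrite !ffunE /=; have -> : `|(n + h%:Z)%R|%N%:Z - h%:Z = n by lia.
by move=> e; rewrite levalD levalN lcoefD lcoefN e subrr.
Qed.

End Minkowski.

(* The argument of Davenport and Schmidt. Along a sequence of polynomials     *)
(* with decreasing values |P(xi)| and minimal heights, suppose that            *)
(* |P'(xi)| < |P(xi)| H(P)^3 always. If [k] is such that the polynomials of    *)
(* index k, k+1, k+2 are independent and [l > k] is the next such index, then  *)
(* the determinant of the polynomials of index k, k+1, l+1 forces              *)
(* (H_(l+2) / H_(l+1))^2 < H_(k+2) / H_(k+1): an infinite descent.             *)
Section DavenportSchmidt.
Variables (F : finFieldType) (xi : laurent F).
Hypothesis xi1 : vanishes_below xi 1.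
Hypothesis not_quadratic : forall P : {poly {poly F}},
  (size P <= 3)%N -> P != 0 -> leval xi P != 0.
Implicit Types P Q S : {poly {poly F}}.

Lemma lorderP (x : laurent F) : x != 0 -> is_lorder x (lorder x).
Proof. by move=> /lorder_ex[N xN]; rewrite /lorder; case: xgetP => // /(_ N). Qed.

(** The successor of P in the sequence of minimal points: least height among polynomials of strictly
    smaller value, the [+ 1] making the decrease strict. *)
Definition next_minimal P Q : Prop :=
  [/\ Q != 0, (size Q <= 3)%N, vanishes_below (leval xi Q) (lorder (leval xi P) + 1)
    & forall S, S != 0 -> (size S <= 3)%N ->
        vanishes_below (leval xi S) (lorder (leval xi P) + 1) -> (hgt Q <= hgt S)%N].

Lemma next_minimal_ex P : exists Q, next_minimal P Q.
Proof.
set N := lorder (leval xi P) + 1.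
pose good Q := [/\ Q != 0, (size Q <= 3)%N & vanishes_below (leval xi Q) N].
have ex : exists h, `[< exists Q, good Q /\ hgt Q = h >].
  have [Q [Q0 sQ hQ vQ]] := small_value_ex xi1 `|N|.
  exists (hgt Q); apply/asboolP; exists Q; split=> //; split=> //.
  by apply: vanishes_le vQ; lia.
case: (ex_minnP ex) => h /asboolP[Q [[Q0 sQ vQ] hQ]] hmin.
exists Q; split=> // S S0 sS vS; rewrite hQ; apply: hmin; apply/asboolP.
by exists S.
Qed.

Definition next P : {poly {poly F}} := xget 0 (next_minimal P).

Lemma nextP P : next_minimal P (next P).
Proof. by have [Q PQ] := next_minimal_ex P; rewrite /next; apply: (xgetI _ PQ). Qed.

Definition minseq (k : nat) := iter k next 1.

Local Notation L k := (leval xi (minseq k)).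
Local Notation D k := (lderiv xi (minseq k)).
Local Notation N k := (lpoly (minseq k)`_2).
Local Notation h k := (hgt (minseq k)).
Local Notation l k := (lorder (L k)).

Lemma minseq_neq0 k : minseq k != 0.
Proof. by case: k => [|k]; [exact: oner_neq0|have [] := nextP (minseq k)]. Qed.

Lemma size_minseq k : (size (minseq k) <= 3)%N.
Proof. by case: k => [|k]; [rewrite size_poly1|have [] := nextP (minseq k)]. Qed.

Lemma lorder_minseq k : is_lorder (L k) (l k).
Proof. by apply/lorderP/not_quadratic; [exact: size_minseq|exact: minseq_neq0]. Qed.

Lemma l0 : l 0 = 0.
Proof.
apply: lorder_uniq (lorder_minseq 0) _.
by rewrite /leval rmorph1 hornerC; exact: lorder1.
Qed.

Lemma l_lt k : l k < l k.+1.
Proof.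
have [_ _ v _] := nextP (minseq k).
by have := vanishes_lorder v (lorder_minseq k.+1); lia.
Qed.

Lemma l_le i j : (i <= j)%N -> l i <= l j.
Proof.
move=> /subnK <-; elim: (j - i)%N => // n IHn.
by apply: le_trans IHn _; exact/ltW/l_lt.
Qed.

Lemma l_ge k : k%:Z <= l k.
Proof. by elim: k => [|k IHk]; [rewrite l0|have := l_lt k; lia]. Qed.

Lemma h_leS k : (h k <= h k.+1)%N.
Proof.
case: k => [|k].
  apply: (@leq_trans 0) => //; apply: hgt_le => i.
  by rewrite /= coef1; case: i => [|i]; rewrite ?size_poly1 ?size_poly0.
have [_ _ _ hmin] := nextP (minseq k).
have [n0 sn v _] := nextP (minseq k.+1).
by apply: hmin => //; apply: vanishes_le v; have := l_lt k; lia.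
Qed.

Lemma h_le i j : (i <= j)%N -> (h i <= h j)%N.
Proof. exact: (homo_leq leqnn leq_trans h_leS). Qed.

(** Otherwise [small_value_ex] would give a polynomial of height below that of [minseq k.+1] whose
    value already beats that of [minseq k]. *)
Lemma minkowski_minseq k : 2 * (h k.+1)%:Z <= l k.
Proof.
case hE : (h k.+1) => [|h']; first by have := l_ge k; lia.
rewrite leNgt; apply/negP => lk.
have [Q [Q0 sQ hQ vQ]] := small_value_ex xi1 h'.
have [_ _ _ hmin] := nextP (minseq k).
have : (h k.+1 <= hgt Q)%N.
  by apply: hmin => //; apply: vanishes_le vQ; lia.
by rewrite hE; lia.
Qed.

(** The finitely many polynomials of bounded height have values of bounded order, whereas the order
    of the k-th value is at least k. *)
Lemma h_unbounded (h0 : nat) : exists K, forall k, (K <= k)%N -> (h0 <= h k)%N.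
Proof.
suff [K hK] : exists K, (h0 < h K)%N.
  by exists K => k Kk; apply: leq_trans (ltnW hK) _; exact: h_le.
apply: contrapT => H.
have hk k : (h k <= h0)%N by rewrite leqNgt; apply/negP => hk; apply: H; exists k.
have [||n nP] := @finite_set_uniform_bound _ _
  (fun P n => P = 0 \/ lorder (leval xi P) <= n%:Z) (finite_bounded_height F 3 h0).
- by move=> P _; exists `|lorder (leval xi P)|%N; right; lia.
- by move=> P i j ij [->|]; [left|right; lia].
have [/eqP|] := nP (minseq n.+1) (conj (size_minseq _) (hk _)).
  by rewrite (negPf (minseq_neq0 _)).
by have := l_ge n.+1; lia.
Qed.

Definition det3 (A : pzRingType) (x1 y1 z1 x2 y2 z2 x3 y3 z3 : A) : A :=
  x1 * (y2 * z3 - y3 * z2) - y1 * (x2 * z3 - x3 * z2) + z1 * (x2 * y3 - x3 * y2).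

Definition detP P Q S : {poly F} :=
  det3 P`_0 P`_1 P`_2 Q`_0 Q`_1 Q`_2 S`_0 S`_1 S`_2.

(** Unipotent column operations replace the coefficient columns by P(xi), P'(xi) and the leading
    coefficient. *)
Lemma lpoly_detP P Q S : (size P <= 3)%N -> (size Q <= 3)%N -> (size S <= 3)%N ->
  lpoly (detP P Q S) = det3 (leval xi P) (lderiv xi P) (lpoly P`_2)
    (leval xi Q) (lderiv xi Q) (lpoly Q`_2) (leval xi S) (lderiv xi S) (lpoly S`_2).
Proof.
move=> sP sQ sS; rewrite !leval3// !lderiv3// /detP /det3.
by rewrite !(lpolyD, lpolyN, lpolyM); ring.
Qed.

Local Notation I k := (detP (minseq k) (minseq k.+1) (minseq k.+2)).

Section Descent.
Variable h0 : nat.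
Hypothesis lderiv_small : forall P (n d : int), (size P <= 3)%N ->
  is_lorder (leval xi P) n -> is_lorder (lderiv xi P) d -> (h0 <= hgt P)%N ->
  n - d < 3 * (hgt P)%:Z.
Variable K : nat.
Hypothesis hK : forall k, (K <= k)%N -> (h0.+1 <= h k)%N.

Lemma vanishes_D k : (K <= k)%N -> vanishes_below (D k) (l k - 3 * (h k)%:Z + 1).
Proof.
move=> Kk; have [->|D0] := eqVneq (D k) 0; first exact: vanishes0.
have [d Dd] := lorder_ex D0.
apply: vanishes_le (lorder_vanishes Dd).
have := lderiv_small (size_minseq k) (lorder_minseq k) Dd (ltnW (hK Kk)); lia.
Qed.

(** Here |xi| < 1, and |P(xi)| and |P'(xi)| are smaller than H. If the coefficient of X^2 were
    smaller than H, then so would be that of X, read off from P'(xi), and the constant one, read off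
    from P(xi); no coefficient would attain the height. *)
Lemma lorder_N k : (K <= k)%N -> is_lorder (N k) (- (h k)%:Z).
Proof.
move=> Kk; have hk := hK Kk.
have c i : vanishes_below (lpoly (minseq k)`_i) (- (h k)%:Z).
  exact/vanishes_lpoly/size_coef_hgt.
split; last exact: c; apply/eqP => N0.
have {}N0 : vanishes_below (N k) (- (h k)%:Z + 1).
  move=> n nh; have [->//|nh'] := eqVneq n (- (h k)%:Z).
  by apply: c; move: nh'; rewrite neq_lt => /orP[]; lia.
have v1 := minkowski_minseq k; have v2 := h_leS k.
have B0 : vanishes_below (lpoly (minseq k)`_1) (- (h k)%:Z + 1).
  have -> : lpoly (minseq k)`_1 = D k - N k * xi *+ 2.
    by rewrite lderiv3 ?size_minseq//; ring.
  apply: vanishesB; first by apply: vanishes_le (vanishes_D Kk); lia.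
  have Nxi : vanishes_below (N k * xi) (- (h k)%:Z + 1).
    by apply: (vanishesM _ N0 xi1); lia.
  by rewrite mulr2n; exact: vanishesD.
have C0 : vanishes_below (lpoly (minseq k)`_0) (- (h k)%:Z + 1).
  have -> : lpoly (minseq k)`_0 = L k - N k * xi * xi - lpoly (minseq k)`_1 * xi.
    by rewrite leval3 ?size_minseq//; ring.
  apply: vanishesB; last by apply: (vanishesM _ B0 xi1); lia.
  apply: vanishesB; first by apply: vanishes_le (lorder_vanishes (lorder_minseq k)); lia.
  apply: (@vanishesM _ _ _ (- (h k)%:Z + 1) 1) => //; first by lia.
  by apply: (vanishesM _ N0 xi1); lia.
have [i] := hgt_attained (minseq_neq0 k).
have hE : (h k).-1.+1 = h k by lia.
have small j : vanishes_below (lpoly (minseq k)`_j) (- (h k)%:Z + 1) ->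
    (size ((minseq k)`_j)%R <= h k)%N.
  by move=> v; rewrite -[leqRHS]hE; apply/vanishes_lpoly; apply: vanishes_le v; lia.
case: i => [|[|[|i]]] si.
- by have := small _ C0; rewrite si ltnn.
- by have := small _ B0; rewrite si ltnn.
- by have := small _ N0; rewrite si ltnn.
by move: si; rewrite nth_default ?size_poly0// (leq_trans (size_minseq k)).
Qed.

Definition wedge i j := L i * N j - L j * N i.

Lemma lorder_wedge i j : (K <= i)%N -> (i < j)%N ->
  is_lorder (wedge i j) (l i - (h j)%:Z).
Proof.
move=> Ki ij; have Kj := leq_trans Ki (ltnW ij).
apply: lorderDl; first exact: lorderM (lorder_minseq i) (lorder_N Kj).
apply: vanishesN.
apply: (vanishesM _ (lorder_vanishes (lorder_minseq j)) (lorder_vanishes (lorder_N Ki))).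
by have := l_lt i; have := l_le ij; have := h_le (ltnW ij); lia.
Qed.

(** If all later determinants vanished, the linear polynomials t_k X + s_k, whose values at xi are
    the wedges, would be proportional. Those values tend to 0, so eventually s_k and t_k have
    absolute value less than 1 and are zero, although the wedges are not. *)
Lemma independent_ex K' : (K <= K')%N -> exists2 k, (K' <= k)%N & I k != 0.
Proof.
move=> KK'; apply: contrapT => H.
have I0 k : (K' <= k)%N -> I k = 0.
  by move=> k1; apply/eqP/negPn/negP => Ik; apply: H; exists k.
pose s k := (minseq k)`_0 * (minseq k.+1)`_2 - (minseq k.+1)`_0 * (minseq k)`_2.
pose t k := (minseq k)`_1 * (minseq k.+1)`_2 - (minseq k.+1)`_1 * (minseq k)`_2.
have w0 k : (K' <= k)%N -> wedge k k.+1 != 0.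
  move=> K'k; apply: lorder_neq0 (lorder_wedge (leq_trans KK' K'k) (ltnSn k)).
have wE k : wedge k k.+1 = lpoly (t k) * xi + lpoly (s k).
  rewrite /wedge !leval3 ?size_minseq// /s /t !(lpolyD, lpolyN, lpolyM); ring.
(* The cross difference of the two linear forms is the determinant of index k times the leading
   coefficient of [minseq k.+1]. *)
have st k : (K' <= k)%N -> lpoly (s k) * lpoly (t k.+1) = lpoly (s k.+1) * lpoly (t k).
  move=> K'k; rewrite -!lpolyM; congr lpoly; apply/eqP; rewrite -subr_eq0; apply/eqP.
  transitivity ((minseq k.+1)`_2 * I k); last by rewrite I0// mulr0.
  rewrite /s /t /detP /det3; ring.
have const k : (K' <= k)%N ->
    lpoly (s k) / wedge k k.+1 = lpoly (s K') / wedge K' K'.+1 /\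
    lpoly (t k) / wedge k k.+1 = lpoly (t K') / wedge K' K'.+1.
  move=> /subnK <-; elim: (k - K')%N => // n [IHs IHt].
  have K'n : (K' <= n + K')%N by exact: leq_addl.
  have K'n1 : (K' <= (n + K').+1)%N by exact: leqW.
  rewrite addSn -IHs -IHt; have := st _ K'n; have := w0 _ K'n1; have := w0 _ K'n.
  rewrite !wE; move: (lpoly _) (lpoly _) (lpoly _) (lpoly _) => t1 s1 t2 s2 W1 W2 e.
  split; apply/eqP; rewrite eqr_div//; apply/eqP.
    transitivity (t1 * s2 * xi + t1 * t2); first by ring.
    by rewrite -e; ring.
  transitivity (s1 * s2 * xi + t2 * s1); first by ring.
  by rewrite e; ring.
have ord_ge (u : {poly F}) : exists m, forall k, (m <= k)%N -> (K' <= k)%N ->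
    vanishes_below (lpoly u / wedge K' K'.+1 * wedge k k.+1) 1.
  have [->|u0] := eqVneq u 0.
    by exists 0%N => k _ _; rewrite rmorph0 !mul0r.
  have [M uM] : exists M, is_lorder (lpoly u / wedge K' K'.+1) M.
    by apply: lorder_ex; rewrite mulf_neq0 ?invr_eq0 ?w0// lpoly_eq0.
  have [m mP] := h_unbounded `|M|.+1.
  exists m => k mk K'k.
  have := lorder_vanishes (lorder_wedge (leq_trans KK' K'k) (ltnSn k)).
  apply: (vanishesM _ (lorder_vanishes uM)).
  by have := minkowski_minseq k; have := mP k.+1 (leqW mk); lia.
have [m1 m1P] := ord_ge (s K'); have [m2 m2P] := ord_ge (t K').
pose k := (K' + m1 + m2)%N.
have K'k : (K' <= k)%N by rewrite /k; lia.
have [ks kt] := const k K'k; have wk := w0 k K'k.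
have s0 : s k = 0.
  apply: lpoly_vanishes1; rewrite -[lpoly _](divfK wk) ks; apply: m1P => //; rewrite /k; lia.
have t0 : t k = 0.
  apply: lpoly_vanishes1; rewrite -[lpoly _](divfK wk) kt; apply: m2P => //; rewrite /k; lia.
by move: wk; rewrite wE s0 t0 rmorph0 mul0r addr0 eqxx.
Qed.

(** Each vanishing determinant keeps the next vector of values, derivatives and leading coefficients
    in the plane of the two preceding ones; the nonzero wedge ensures that these two span a
    plane. *)
Lemma span_of_dependent k m : (K <= k)%N ->
  (forall j, (k < j < m)%N -> I j = 0) ->
  forall j, (k < j <= m.+1)%N -> exists x y : laurent F,
    [/\ L j = x * L k.+1 + y * L k.+2, D j = x * D k.+1 + y * D k.+2
      & N j = x * N k.+1 + y * N k.+2].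
Proof.
move=> Kk Ij; elim/ltn_ind => j IHj /andP[kj jm].
have [->|jk1] := eqVneq j k.+1; first by exists 1, 0; split; ring.
have [->|jk2] := eqVneq j k.+2; first by exists 0, 1; split; ring.
have [i jE] : exists i, j = i.+2 by exists j.-2; lia.
rewrite {}jE in IHj kj jm jk1 jk2 *.
have i1 : (k < i <= m.+1)%N by lia.
have i2 : (k < i.+1 <= m.+1)%N by lia.
have [x1 [y1 [L1 D1 N1]]] := IHj i (leqW (ltnSn i)) i1.
have [x2 [y2 [L2 D2 N2]]] := IHj i.+1 (ltnSn _) i2.
have Ii : I i = 0 by apply: Ij; lia.
have w0 : wedge i i.+1 != 0.
  by apply: lorder_neq0 (lorder_wedge _ (ltnSn i)); lia.
have := lpoly_detP (size_minseq i) (size_minseq i.+1) (size_minseq i.+2).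
rewrite Ii rmorph0 => /esym d0.
have [x [y [L3 D3 N3]]] : exists x y : laurent F,
    [/\ L i.+2 = x * L i + y * L i.+1, D i.+2 = x * D i + y * D i.+1
      & N i.+2 = x * N i + y * N i.+1].
  (* Cramer's rule on values and leading coefficients; the derivative coordinate follows from the
     vanishing determinant. *)
  exists (wedge i.+2 i.+1 / wedge i i.+1), (wedge i i.+2 / wedge i i.+1).
  move: w0 d0; rewrite /wedge /det3.
  move: (L i) (L i.+1) (L i.+2) (D i) (D i.+1) (D i.+2) (N i) (N i.+1) (N i.+2).
  move=> a1 a2 a3 b1 b2 b3 c1 c2 c3 w0 d0.
  have red U V u v : (U / (a1 * c2 - a2 * c1) * u + V / (a1 * c2 - a2 * c1) * v)
      * (a1 * c2 - a2 * c1) = U * u + V * v by field.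
  split; apply: (mulIf w0); rewrite red; try ring.
  by apply/eqP; rewrite -subr_eq0 -oppr_eq0 -d0; apply/eqP; ring.
exists (x * x1 + y * x2), (x * y1 + y * y2).
have comb (u w p1 p2 p3 : laurent F) : p1 = x1 * u + y1 * w -> p2 = x2 * u + y2 * w ->
    p3 = x * p1 + y * p2 -> p3 = (x * x1 + y * x2) * u + (x * y1 + y * y2) * w.
  by move=> -> -> ->; ring.
by split; [exact: comb L1 L2 L3|exact: comb D1 D2 D3|exact: comb N1 N2 N3].
Qed.

Lemma descent_step k m : (K <= k)%N -> (k < m)%N -> I k != 0 ->
  (forall j, (k < j < m)%N -> I j = 0) ->
  2 * ((h m.+2)%:Z - (h m.+1)%:Z) < (h k.+2)%:Z - (h k.+1)%:Z.
Proof.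
move=> Kk km Ik Ij.
have [|x [y [Lm Dm Nm]]] := span_of_dependent Kk Ij (j := m.+1); first by lia.
have detE : lpoly (detP (minseq k) (minseq k.+1) (minseq m.+1)) = y * lpoly (I k).
  by rewrite !lpoly_detP ?size_minseq// Lm Dm Nm /det3; ring.
have yE : wedge k.+1 m.+1 = y * wedge k.+1 k.+2 by rewrite /wedge Lm Nm; ring.
have Kk1 := leqW Kk; have Km : (K <= m.+1)%N by lia.
have w1 := lorder_wedge Kk1 (ltnSn k.+1).
have km1 : (k.+1 < m.+1)%N by [].
have yord : is_lorder y ((h k.+2)%:Z - (h m.+1)%:Z).
  have := lorderM (lorder_wedge Kk1 km1) (lorderV w1).
  rewrite yE mulfK ?(lorder_neq0 w1)//.
  by congr is_lorder; ring.
have detord := lorderM yord (lorder_lpoly Ik).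
rewrite -detE lpoly_detP ?size_minseq// /det3 in detord.
(* The assumption [H] enters through the product of L_k, D_(m+1) and N_(k+1); the other five follow
   from the monotonicity of heights and [minkowski_minseq]. *)
rewrite ltNge; apply/negP => H.
set v := (X in is_lorder _ X) in detord.
suff /vanishes_lorder/(_ detord) :
  vanishes_below (det3 (L k) (D k) (N k) (L k.+1) (D k.+1) (N k.+1)
    (L m.+1) (D m.+1) (N m.+1)) ((h k.+2)%:Z - (h m.+1)%:Z + 1) by rewrite /v; lia.
have lL i := lorder_vanishes (lorder_minseq i).
have lN i (Ki : (K <= i)%N) := lorder_vanishes (lorder_N Ki).
have := minkowski_minseq k; have := minkowski_minseq k.+1; have := minkowski_minseq m.+1.
have := h_leS k; have := h_leS k.+1; have := h_leS m.+1; have := @h_le k.+2 m.+1 km.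
have M3 i1 i2 i3 : (K <= i2)%N -> (K <= i3)%N ->
    (h k.+2)%:Z - (h m.+1)%:Z + 1 <= l i1 + (l i2 - 3 * (h i2)%:Z + 1) - (h i3)%:Z ->
    vanishes_below (L i1 * D i2 * N i3) ((h k.+2)%:Z - (h m.+1)%:Z + 1).
  move=> Ki2 Ki3 le1; apply: (vanishesM le1 _ (lN _ Ki3)).
  exact: (vanishesM (lexx _) (lL _) (vanishes_D Ki2)).
move=> e1 e2 e3 e4 e5 e6 e7.
rewrite /det3.
match goal with |- vanishes_below (lcoef ?w) _ => have -> : w =
  L k * D k.+1 * N m.+1 - L k * D m.+1 * N k.+1 - L k.+1 * D k * N m.+1
  + L m.+1 * D k * N k.+1 + L k.+1 * D m.+1 * N k - L m.+1 * D k.+1 * N k by ring end.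
apply: vanishesB; last by apply: M3 => //; lia.
apply: vanishesD; last by apply: M3 => //; lia.
apply: vanishesD; last by apply: M3 => //; lia.
apply: vanishesB; last by apply: M3 => //; lia.
apply: vanishesB; last by apply: M3 => //; lia.
by apply: M3 => //; lia.
Qed.

(** The gap h_(k+2) - h_(k+1) more than halves from one independent index to the next, which is
    impossible for natural numbers. *)
Lemma descent_false : False.
Proof.
have [k0 Kk0 Ik0] := independent_ex (leqnn K).
suff H r k : (K <= k)%N -> I k != 0 -> (h k.+2 - h k.+1)%N = r -> False by exact: H Kk0 Ik0 erefl.
elim/ltn_ind: r k => r IHr k Kk Ik rE.
have ex : exists m, (k < m)%N && (I m != 0).
  by have [m km Im] := independent_ex (leqW Kk); exists m; rewrite km.
case: (ex_minnP ex) => m /andP[km Im] mmin.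
have Ij j : (k < j < m)%N -> I j = 0.
  move=> /andP[kj jm]; apply/eqP/negPn/negP => Ij.
  by have := mmin j; rewrite kj Ij => /(_ isT); lia.
have step := descent_step Kk km Ik Ij.
apply: IHr Im erefl; last by lia.
by have := h_leS m.+1; have := h_leS k.+1; lia.
Qed.

End Descent.

Lemma large_derivative (h0 : nat) : exists P (n d : int), [/\ (size P <= 3)%N,
  is_lorder (leval xi P) n, is_lorder (lderiv xi P) d, (h0 <= hgt P)%N
  & 3 * (hgt P)%:Z <= n - d].
Proof.
apply: contrapT => H; have [K hK] := h_unbounded h0.+1.
apply: (@descent_false h0 _ K hK) => P n d sP Pn Pd hP.
by rewrite ltNge; apply/negP => le1; apply: H; exists P, n, d.
Qed.

End DavenportSchmidt.

(** * Repetitions and growth rates *)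

Section LimInfSup.
Variables (R : realType) (u : R^o^nat) (b B : R).
Hypothesis u_bnd : forall n, b <= u n <= B.

Let u_ub : has_ubound (range u).
Proof. by exists B => _ [n _ <-]; case/andP: (u_bnd n). Qed.

Let u_lb : has_lbound (range u).
Proof. by exists b => _ [n _ <-]; case/andP: (u_bnd n). Qed.

Lemma limn_inf_gt c : c < limn_inf u -> exists N, forall n, (N <= n)%N -> c < u n.
Proof.
rewrite /limn_inf (cvg_lim _ (cvg_infs_sup u_ub u_lb))// => /sup_gt[].
  by exists (infs u 0%N); exists 0%N.
move=> _ [N _ <-] cN; exists N => n Nn; apply: lt_le_trans cN _.
by apply: ge_inf; [exact: has_lbound_sdrop|exists n].
Qed.

Lemma limn_sup_lt c : limn_sup u < c -> exists N, forall n, (N <= n)%N -> u n < c.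
Proof.
rewrite /limn_sup (cvg_lim _ (cvg_sups_inf u_ub u_lb))// => /inf_lt[].
  by exists (sups u 0%N); exists 0%N.
move=> _ [N _ <-] Nc; exists N => n Nn; apply: le_lt_trans Nc.
by apply: ub_le_sup; [exact: has_ubound_sdrop|exists n].
Qed.

Lemma limn_inf_ge : b <= limn_inf u.
Proof.
rewrite /limn_inf (cvg_lim _ (cvg_infs_sup u_ub u_lb))//.
apply: (@le_trans _ _ (infs u 0%N)).
  apply: lb_le_inf; first by exists (u 0%N); exists 0%N.
  by move=> _ [n _ <-]; case/andP: (u_bnd n).
apply: ub_le_sup; last by exists 0%N.
exists B => _ [n _ <-]; apply: (@le_trans _ _ (u n)); last by case/andP: (u_bnd n).
by apply: ge_inf; [exact: has_lbound_sdrop|exists n => /=].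
Qed.

Lemma limn_inf_le_sup : limn_inf u <= limn_sup u.
Proof.
rewrite leNgt; apply/negP => ub.
pose c := (limn_sup u + limn_inf u) / 2.
have [|N NP] := @limn_inf_gt c; first by rewrite /c; lra.
have [|N' NP'] := @limn_sup_lt c; first by rewrite /c; lra.
have := NP (maxn N N') (leq_maxl _ _); have := NP' (maxn N N') (leq_maxr _ _).
by move=> /lt_trans h /h; rewrite ltxx.
Qed.

End LimInfSup.

(** * Repetitions extracted from the Diophantine exponent *)

Section Repetitions.
Variables (R : realType) (A : Type) (s : nat -> A).
Implicit Types (U V W : seq A).

Lemma nth_repeat W p m i x0 : (i < size (flatten (nseq m W) ++ take p W))%N ->
  nth x0 (flatten (nseq m W) ++ take p W) i = nth x0 W (i %% size W).
Proof.
elim: m i => [|m IHm] i /=.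
  rewrite size_take_min leq_min => /andP[ip iW].
  by rewrite nth_take// modn_small.
rewrite -catA size_cat nth_cat => iW; case: ltnP => Wi; first by rewrite modn_small.
rewrite IHm; last by rewrite ltn_subLR.
by congr (nth _ _ _); rewrite -[in RHS](subnK Wi) modnDr.
Qed.

(** Take r = |U|, t = |UV| and t + j = |U V^w|; the last exceeds any N because the lengths of V^w
    increase strictly. *)
Lemma condition_star_repetition rho : 1 < rho -> condition_star s rho ->
  forall N : nat, exists r t j, [/\ (r < t)%N,
    forall i, (i < j)%N -> s (r + i)%N = s (t + i)%N,
    rho * t%:R <= (t + j)%:R :> R & (N <= t + j)%N].
Proof.
move=> rho1 [U [V [w [w0 pre ratio incr]]]] N.
have size_ge n : (n <= size (word_pow (V n) (w n)))%N.
  by elim: n => // n IHn; apply: leq_ltn_trans IHn (incr n).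
have := size_ge N.+1; have := ratio N.+1; have := pre N.+1.
move: (U _) (V _) (w _) => {size_ge pre ratio incr w0} {}U {}V {}w.
set X := U ++ word_pow V w => preX ratioX sizeX.
(* All powers of an empty V are empty, against the length of V^w; this yields r < t. *)
have sV : (0 < size V)%N.
  case: V @X preX ratioX sizeX => // X _ _; rewrite /word_pow /= cats0.
  by elim: `|_|%N.
have sUV : (0 : R) < (size (U ++ V))%:R by rewrite ltr0n size_cat addn_gt0 sV orbT.
move: ratioX; rewrite ler_pdivlMr// => ratioX.
have tX : (size (U ++ V) <= size X)%N.
  rewrite -(ler_nat R); apply: le_trans ratioX.
  by rewrite ler_peMl// ltW.
have sX k : (size U + k < size X)%N -> forall x0, s (size U + k)%N = nth x0 V (k %% size V).
  move=> kX x0; transitivity (nth x0 X (size U + k)).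
    by rewrite preX nth_mkseq.
  rewrite nth_cat ltnNge leq_addr /= addKn; apply: nth_repeat.
  by move: kX; rewrite /X size_cat ltn_add2l.
exists (size U), (size (U ++ V)), (size X - size (U ++ V))%N; split.
- by rewrite size_cat -[ltnLHS]addn0 ltn_add2l.
- move=> i iX; have x0 := s 0%N.
  have iX' : (size U + (size V + i) < size X)%N.
    by rewrite addnA -size_cat -ltn_subRL.
  rewrite (sX i _ x0); last by apply: leq_ltn_trans iX'; rewrite leq_add2l leq_addl.
  by rewrite size_cat -addnA (sX _ iX' x0) modnDl.
- by rewrite subnKC.
- rewrite subnKC// /X size_cat; apply: leq_trans (leq_addl _ _).
  exact: ltnW.
Qed.

End Repetitions.

(** For finite x the bound is solved for rho before taking the supremum, which excludes an infinite
    one. *)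
Lemma ereal_sup_affine (R : realType) (S : set R) (mu c : R) (x : \bar R) :
  0 < mu -> x != -oo%E -> (forall rho, S rho -> ((mu * (rho + c) - 1)%:E <= x)%E) ->
  (mu%:E * (ereal_sup [set rho%:E | rho in S] + c%:E) - 1%:E <= x)%E.
Proof.
move=> mu0; case: x => [x| |] // _ Sx; last by rewrite leey.
have : (ereal_sup [set rho%:E | rho in S] <= ((x + 1) / mu - c)%:E)%E.
  apply: ub_ereal_sup => _ [rho Srho <-]; have := Sx _ Srho; rewrite !lee_fin => h.
  by rewrite lerBrDr ler_pdivlMr//; lra.
case: (ereal_sup _) => [d| |] //=.
  by rewrite !lee_fin => h; move: h; rewrite lerBrDr ler_pdivlMr//; lra.
by move=> _; rewrite gt0_muleNy ?lte_fin//= leNye.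
Qed.

(** * Comparison of growth rates and lower bounds for the exponents *)

Section QuadraticExponents.
Variables (R : realType) (F : finFieldType) (Omega : closedFieldType).
Variables (iota : {rmorphism laurent F -> Omega}) (v : Omega -> R).
Hypothesis v_abs : is_absolute_value v.
Hypothesis v_ext : forall x : laurent F, v (iota x) = labs R x.
Variables (a : nat -> {poly F}) (xi : laurent F).
Hypothesis a0 : a 0%N = 0.
Hypothesis a_deg : forall n, (1 <= n)%N -> (1 <= (size (a n)).-1)%N.
Hypothesis a_aper : ~ ultimately_periodic (fun n => a n.+1).
Hypothesis xi_cf : is_cf_value R a xi.

Local Notation w2 := (mahler_w R 2 xi).
Local Notation w2s := (koksma_w iota v 2 xi).
Local Notation e n := (cfdeg a n).

Let xi1 : vanishes_below xi 1 := vanishes_xi a0 a_deg xi_cf.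
Let xi_neq0 := leval_neq0 a0 a_deg xi_cf a_aper.

Lemma mahler_ge2 : (2%:E <= w2)%E.
Proof.
apply: mahler_ge => N; have [P [P0 sP hP vP]] := small_value_ex xi1 N.
have [n Pn] := lorder_ex (xi_neq0 sP P0); exists P, n.
have nN := vanishes_lorder vP Pn; split=> //; first by lia.
have : (2 * N%:Z)%:~R <= n%:~R :> R by rewrite ler_int; lia.
have : (hgt P)%:R <= N%:R :> R by rewrite ler_nat.
by rewrite intrM -[N%:Z%:~R]/(N%:R); lra.
Qed.

Lemma koksma_ge2 : (2%:E <= w2s)%E.
Proof.
apply: lee_from_below => w' w'2.
pose w := Num.max w' 0; have w0 : 0 <= w by rewrite le_max lexx orbT.
have w2 : w < 2 by rewrite gt_max w'2 /=; lra.
apply: (@le_trans _ _ w%:E); first by rewrite lee_fin le_max lexx.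
apply: koksma_ge => // N.
(* A height of at least 1 / (2 - w) turns 3 h into at least h (w + 1) + 1. *)
pose h0 := (N + Num.bound (2 - w)^-1)%N.
have [P [n [d [sP Pn Pd hP big]]]] := large_derivative xi1 xi_neq0 h0.
exists P, n, d; split=> //; first by rewrite /h0 in hP; lia.
have : (3 * (hgt P)%:Z)%:~R <= (n - d)%:~R :> R by rewrite ler_int.
rewrite intrM -[(hgt P)%:Z%:~R]/((hgt P)%:R).
have iw : (2 - w)^-1 <= (hgt P)%:R.
  apply: (@le_trans _ _ (Num.bound (2 - w)^-1)%:R).
    by apply/ltW/archi_boundP; rewrite invr_ge0; lra.
  by rewrite ler_nat; apply: leq_trans hP; exact: leq_addl.
have : 1 <= (hgt P)%:R * (2 - w) by rewrite -ler_pdivrMr ?subr_gt0// div1r.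
lra.
Qed.

Lemma koksma_le_mahler2 : (w2s <= w2)%E.
Proof. exact: (koksma_le_mahler v_abs v_ext mahler_ge2). Qed.

(* [lam] and [Lam] stand for log m / log q and log M / log q. *)
Variables lam Lam : R.
Hypothesis lam_ge1 : 1 <= lam.
Hypothesis lam_le : lam <= Lam.
Hypothesis lam_lower : forall c, c < lam ->
  exists C : R, 0 <= C /\ forall n, c * n%:R - C <= (e n)%:R.
Hypothesis Lam_upper : forall c, Lam < c ->
  exists C : R, 0 <= C /\ forall n, (e n)%:R <= c * n%:R + C.

(** The strict inequality leaves room for c1 < c2 < lam and c3 > Lam with y c3 = s c1; the gap c2 -
    c1 later absorbs all additive constants. *)
Lemma growth_constants (y s : R) : 0 < y -> 0 < s -> y * Lam < s * lam ->
  exists c1 c2 c3 C : R, [/\ c1 < c2, 0 < c1, y * c3 <= s * c1,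
    forall n, c2 * n%:R - C <= (e n)%:R & forall n, (e n)%:R <= c3 * n%:R + C].
Proof.
move=> y0 s0 ys; pose l0 := y * Lam / s.
have l0lam : l0 < lam by rewrite /l0 ltr_pdivrMr// [lam * s]mulrC.
have l00 : 0 < l0 by apply: divr_gt0 => //; apply: mulr_gt0 => //; exact: lt_le_trans ltr01 (le_trans lam_ge1 lam_le).
pose g := (lam - l0) / 3; have g0 : 0 < g by rewrite /g; lra.
have [|C1 [C10 lowC]] := @lam_lower (l0 + g + g); first by rewrite /g; lra.
have [|C2 [C20 upC]] := @Lam_upper (Lam + s * g / y).
  by rewrite ltrDl divr_gt0// mulr_gt0.
exists (l0 + g), (l0 + g + g), (Lam + s * g / y), (C1 + C2); split; try lra.
- have -> : y * (Lam + s * g / y) = y * Lam + s * g by field; rewrite gt_eqF.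
  have -> : s * (l0 + g) = y * Lam + s * g by rewrite /l0; field; rewrite gt_eqF.
  exact: lexx.
- by move=> n; have := lowC n; lra.
- by move=> n; have := upC n; lra.
Qed.

Lemma linear_beats_constant (c B : R) : 0 < c -> exists K : nat,
  forall k, (K <= k)%N -> B <= c * k%:R.
Proof.
move=> c0; exists (Num.bound (`|B| / c)) => k Kk.
have : `|B| / c < k%:R.
  apply: lt_le_trans (archi_boundP _) _; first by rewrite divr_ge0// ltW.
  by rewrite ler_nat.
rewrite ltr_pdivrMr// mulrC => /ltW; apply: le_trans; exact: ler_norm.
Qed.

(** It suffices that 2 (w + 1) e_t + 1 <= 2 e_k with k = t + j, which follows from e_t <= c3 t + C,
    e_k >= c2 k - C and k >= rho t. *)
Lemma koksma_ge_star (rho : R) :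
  condition_star (fun n => a n.+1) rho -> ((lam / Lam * rho - 1)%:E <= w2s)%E.
Proof.
move=> star; have Lam0 : 0 < Lam by exact: lt_le_trans ltr01 (le_trans lam_ge1 lam_le).
have lL : 0 < lam / Lam <= 1.
  by rewrite ler_pdivrMr// mul1r lam_le andbT divr_gt0// (lt_le_trans ltr01).
(* Repetitions are extracted for rho > 1 only; otherwise the claimed bound is at most 0. *)
have [rho1|rho1] := leP rho 1.
  by apply: le_trans koksma_ge2; rewrite lee_fin; nra.
apply: lee_from_below => w wlt.
have [w0|w0] := leP 0 w; last by apply: le_trans koksma_ge2; rewrite lee_fin; lra.
have wlt' : (w + 1) * Lam < rho * lam.
  have : (w + 1) * Lam < lam / Lam * rho * Lam by rewrite ltr_pM2r//; lra.
  by rewrite mulrAC divfK ?gt_eqF// [lam * rho]mulrC.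
have [||c1 [c2 [c3 [C [c12 c10 yc lowC upC]]]]] := growth_constants _ _ wlt'; [lra|lra|].
have [|K KP] := @linear_beats_constant (c2 - c1) ((w + 1) * C + 1 + C); first lra.
apply: koksma_ge => // N.
have [r [t [j [rt agree rhot Kk]]]] := condition_star_repetition rho1 star (N + K).
have [P [n [sP Pn Pd hP nP]]] := periodic_approximation a0 a_deg xi_cf a_aper rt agree.
exists P, n, ((e r)%:Z - (e t)%:Z); split=> //.
  move: nP Kk (cfdeg_ge a_deg (t + j)%N); move: (e r) (e t) (e (t + j)) => x y z.
  by clear; lia.
have n2 : (2 * (e (t + j))%:Z)%:~R <= (n - ((e r)%:Z - (e t)%:Z))%:~R :> R.
  by rewrite ler_int; move: nP; move: (e r) (e t) (e (t + j)) => x y z; clear; lia.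
apply: le_trans n2; rewrite intrM -[(e (t + j))%:Z%:~R]/((e (t + j))%:R).
have h2 : (hgt P)%:R <= 2 * (e t)%:R :> R.
  rewrite -natrM ler_nat; apply: leq_trans hP _.
  by rewrite mul2n -addnn leq_add2r ltnW// cfdeg_lt.
have := KP _ (leq_trans (leq_addl N K) Kk); have := lowC (t + j)%N; have := upC t.
move: rhot h2; set k : R := (t + j)%:R; set tt : R := t%:R; set H : R := (hgt P)%:R.
move=> rhot h2 et ek kbig.
have s1 : H * (w + 1) <= 2 * (e t)%:R * (w + 1) by apply: ler_wpM2r; lra.
have s2 : (e t)%:R * (w + 1) <= (c3 * tt + C) * (w + 1) by apply: ler_wpM2r; lra.
have s3 : (w + 1) * c3 * tt <= rho * c1 * tt by apply: ler_wpM2r => //; exact: ler0n.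
have s4 : rho * tt * c1 <= k * c1 by apply: ler_wpM2r => //; exact: ltW.
lra.
Qed.

(** Keeping e_r in the height and in the value turns the requirement into (w + 1)(e_r + e_t) <= 2
    (e_r + e_k), sharper than replacing e_r by e_t. *)
Lemma mahler_ge_star (rho : R) :
  condition_star (fun n => a n.+1) rho -> ((lam / Lam * (rho + 1) - 1)%:E <= w2)%E.
Proof.
move=> star; have Lam0 : 0 < Lam by exact: lt_le_trans ltr01 (le_trans lam_ge1 lam_le).
have lL : 0 < lam / Lam <= 1.
  by rewrite ler_pdivrMr// mul1r lam_le andbT divr_gt0// (lt_le_trans ltr01).
have [rho1|rho1] := leP rho 1.
  by apply: le_trans mahler_ge2; rewrite lee_fin; nra.
apply: lee_from_below => w wlt.
have [w0|w0] := leP 0 w; last by apply: le_trans mahler_ge2; rewrite lee_fin; lra.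
have wlt' : (w + 1) * Lam < (rho + 1) * lam.
  have : (w + 1) * Lam < lam / Lam * (rho + 1) * Lam by rewrite ltr_pM2r//; lra.
  by rewrite mulrAC divfK ?gt_eqF// [lam * _]mulrC.
have [||c1 [c2 [c3 [C [c12 c10 yc lowC upC]]]]] := growth_constants _ _ wlt'; [lra|lra|].
have C0 : 0 <= C by have := lowC 0%N; rewrite /= mulr0; lra.
have [|K KP] := @linear_beats_constant (2 * (c2 - c1)) (2 * (w + 1) * C + 4 * C); first lra.
apply: mahler_ge => N.
have [r [t [j [rt agree rhot Kk]]]] := condition_star_repetition rho1 star (N + K).
have [P [n [sP Pn Pd hP nP]]] := periodic_approximation a0 a_deg xi_cf a_aper rt agree.
exists P, n; split=> //.
  move: nP Kk (cfdeg_ge a_deg (t + j)%N) (cfdeg_le a_deg (leq_addr j t)).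
  by move: (e r) (e t) (e (t + j)) => x y z; clear; lia.
have n2 : ((e r)%:Z - (e t)%:Z + 2 * (e (t + j))%:Z)%:~R <= n%:~R :> R by rewrite ler_int.
apply: le_trans n2; rewrite intrD intrB intrM.
rewrite -[(e (t + j))%:Z%:~R]/((e (t + j))%:R) -[(e r)%:Z%:~R]/((e r)%:R) -[(e t)%:Z%:~R]/((e t)%:R).
have h2 : (hgt P)%:R <= (e r)%:R + (e t)%:R :> R by rewrite -natrD ler_nat.
have rtR : r%:R <= t%:R :> R by rewrite ler_nat ltnW.
have r0 : 0 <= r%:R :> R by exact: ler0n.
have := KP _ (leq_trans (leq_addl N K) Kk); have := lowC (t + j)%N; have := upC t.
have := lowC r; have := upC r.
move: rhot h2 rtR r0; set k : R := (t + j)%:R; set tt : R := t%:R; set rr : R := r%:R.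
set H : R := (hgt P)%:R.
move=> rhot h2 rtR r0 er er' et ek kbig.
have s1 : H * w <= ((e r)%:R + (e t)%:R) * w by apply: ler_wpM2r.
have s2 : ((e r)%:R + (e t)%:R) * (w + 1) <= (c3 * (rr + tt) + 2 * C) * (w + 1).
  by apply: ler_wpM2r; lra.
have s3 : (w + 1) * c3 * (rr + tt) <= (rho + 1) * c1 * (rr + tt).
  by apply: ler_wpM2r => //; lra.
(* With k >= rho t, the difference of the two sides is at least (rho - 1)(t - r). *)
have s4 : (rho + 1) * (rr + tt) <= 2 * (rr + k).
  have : 0 <= (rho - 1) * (tt - rr) by apply: mulr_ge0; lra.
  lra.
have s5 : (rho + 1) * (rr + tt) * c1 <= 2 * (rr + k) * c1 by apply: ler_wpM2r => //; exact: ltW.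
have s6 : c1 * rr <= c2 * rr by apply: ler_wpM2r => //; exact: ltW.
lra.
Qed.

End QuadraticExponents.

(** * Growth of the degrees of the convergent denominators *)

Section Growth.
Variables (R : realType) (F : finFieldType) (a : nat -> {poly F}).
Hypothesis a_deg : forall n, (1 <= n)%N -> (1 <= (size (a n)).-1)%N.
Variable B : R.
Hypothesis den_bnd : forall n, (1 <= n)%N -> tabs R (cf_den a n) `^ (n%:R)^-1 <= B.

Local Notation q := (#|F|%:R : R).
Local Notation e n := (cfdeg a n).

Let u : R^o^nat := fun n => tabs R (cf_den a n.+1) `^ (n.+1%:R)^-1.

Let uE n : u n = q `^ ((e n.+1)%:R / n.+1%:R).
Proof.
by rewrite /u cf_denE tabsE ?cfq_neq0// (size_cfq a_deg n.+1).1 height_powR.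
Qed.

Let u_bnd n : q <= u n <= B.
Proof.
rewrite den_bnd// andbT uE -[leLHS]powRr1 ?ler0n// card_ler_powR.
by rewrite ler_pdivlMr ?ltr0n// mul1r ler_nat cfdeg_ge.
Qed.

Let q_gt0 : 0 < q := card_field_gt0 R F.

Let lnq_gt0 : 0 < ln q.
Proof. by rewrite ln_gt0// card_field_gt1. Qed.

Let m := limn_inf u.
Let M := limn_sup u.

Let m_ge : q <= m. Proof. exact: limn_inf_ge u_bnd. Qed.
Let m_gt0 : 0 < m. Proof. exact: lt_le_trans q_gt0 m_ge. Qed.
Let mM : m <= M. Proof. exact: limn_inf_le_sup u_bnd. Qed.
Let M_gt0 : 0 < M. Proof. exact: lt_le_trans m_gt0 mM. Qed.

Lemma log_liminf_ge1 : 1 <= ln m / ln q.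
Proof. by rewrite ler_pdivlMr// mul1r ler_ln ?posrE. Qed.

Lemma log_liminf_limsup : ln m / ln q <= ln M / ln q.
Proof. by rewrite ler_pM2r ?invr_gt0// ler_ln ?posrE. Qed.

Let powRE (c x : R) : 0 < x -> (q `^ c < x) = (c < ln x / ln q).
Proof.
move=> x0; rewrite ltr_pdivlMr// -ln_powR ltr_ln ?posrE// powR_gt0//.
Qed.

(** Beyond some index this is the meaning of the liminf after taking logarithms; the constant C
    takes care of the finitely many earlier terms. *)
Lemma cfdeg_lower c : c < ln m / ln q ->
  exists C : R, 0 <= C /\ forall n, c * n%:R - C <= (e n)%:R.
Proof.
rewrite -powRE// => /(limn_inf_gt u_bnd)[N NP].
exists (`|c| * N.+1%:R); split=> [|n]; first by rewrite mulr_ge0// ler0n.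
have cn : c * n%:R <= `|c| * n%:R by apply: ler_wpM2r; [exact: ler0n|exact: ler_norm].
have e0 : 0 <= (e n)%:R :> R by exact: ler0n.
have C0 : 0 <= `|c| * N.+1%:R by rewrite mulr_ge0// ler0n.
have [nN|Nn] := leqP n N.
  have : `|c| * n%:R <= `|c| * N.+1%:R by apply: ler_wpM2l => //; rewrite ler_nat ltnW.
  lra.
case: n Nn cn e0 => // n Nn cn e0; have := NP n Nn; rewrite uE => /ltW.
by rewrite card_ler_powR ler_pdivlMr ?ltr0n//; lra.
Qed.

Lemma cfdeg_upper c : ln M / ln q < c ->
  exists C : R, 0 <= C /\ forall n, (e n)%:R <= c * n%:R + C.
Proof.
move=> Mc; have : M < q `^ c.
  by rewrite -ltr_ln ?posrE ?powR_gt0// ln_powR -ltr_pdivrMr.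
move=> /(limn_sup_lt u_bnd)[N NP].
have c0 : 0 <= c.
  by apply/ltW/(lt_trans _ Mc)/(lt_le_trans ltr01)/(le_trans log_liminf_ge1)/log_liminf_limsup.
exists (e N)%:R; split=> [|n]; first exact: ler0n.
have [nN|Nn] := leqP n N.
  have : (e n)%:R <= (e N)%:R :> R by rewrite ler_nat cfdeg_le.
  have : 0 <= c * n%:R by rewrite mulr_ge0// ler0n.
  lra.
case: n Nn => // n Nn; have := NP n Nn; rewrite uE => /ltW.
rewrite card_ler_powR ler_pdivrMr ?ltr0n//.
have : 0 <= (e N)%:R :> R by exact: ler0n.
lra.
Qed.

End Growth.

Theorem theorem1p5 (R : realType) (F : finFieldType)
    (* an algebraic closure of F((1/T)) and the extended absolute value *)
    (Omega : closedFieldType) (iota : {rmorphism laurent F -> Omega})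
    (iota_alg : forall z : Omega, algebraicOver iota z)
    (v : Omega -> R) (v_abs : is_absolute_value v)
    (v_ext : forall x : laurent F, v (iota x) = labs R x)
    (* the partial quotients a_0 = 0, a_1, a_2, and so on *)
    (a : nat -> {poly F}) (a0 : a 0%N = 0)
    (a_deg : forall n, (1 <= n)%N -> (1 <= (size (a n)).-1)%N)
    (a_aper : ~ ultimately_periodic (fun n => a n.+1))
    (xi : laurent F) (xi_cf : is_cf_value R a xi)
    (den_bnd : exists B : R, forall n, (1 <= n)%N ->
       tabs R (cf_den a n) `^ (n%:R)^-1 <= B) :
  let u : R^o^nat := fun n => tabs R (cf_den a n.+1) `^ (n.+1%:R)^-1 in
  let m := limn_inf u in
  let M := limn_sup u in
  let D := Dio R (fun n => a n.+1) in
  let w2 := mahler_w R 2 xi in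
  let w2s := koksma_w iota v 2 xi in
  [/\ (w2s <= w2)%E,
      (maxe 2%:E ((ln m / ln M)%:E * D - 1%:E) <= w2s)%E,
      cvgn u -> (maxe 2%:E (D - 1%:E) <= w2s)%E
    & (exists B : R, forall n, (1 <= n)%N -> tabs R (a n) <= B) ->
      (maxe 2%:E ((ln m / ln M)%:E * (D + 1%:E) - 1%:E) <= w2)%E /\
      (cvgn u -> (maxe 2%:E D <= w2)%E)].
Proof.
have [B Bbnd] := den_bnd; move=> u m M D w2 w2s.
have lnq : 0 < ln (#|F|%:R : R) by rewrite ln_gt0// card_field_gt1.
pose lam := ln m / ln (#|F|%:R : R); pose Lam := ln M / ln (#|F|%:R : R).
have lam1 : 1 <= lam := log_liminf_ge1 a_deg Bbnd.
have lamLam : lam <= Lam := log_liminf_limsup a_deg Bbnd.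
have lower c : c < lam -> exists C : R, 0 <= C /\ forall n, c * n%:R - C <= (cfdeg a n)%:R.
  exact: (cfdeg_lower a_deg Bbnd).
have upper c : Lam < c -> exists C : R, 0 <= C /\ forall n, (cfdeg a n)%:R <= c * n%:R + C.
  exact: (cfdeg_upper a_deg Bbnd).
have Lam0 : 0 < Lam by exact: lt_le_trans ltr01 (le_trans lam1 lamLam).
have muE : ln m / ln M = lam / Lam.
  rewrite /lam /Lam invf_div mulrA divfK ?gt_eqF//.
have mu0 : 0 < lam / Lam by rewrite divr_gt0// (lt_le_trans ltr01).
(* The liminf and limsup of a convergent sequence agree, so the quotient of logarithms becomes 1. *)
have mu1 : cvgn u -> lam / Lam = 1.
  move=> /cvg_limn_inf_sup[mE ME]; rewrite /lam /Lam /m /M mE ME divff//.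
  by move: (gt_eqF Lam0); rewrite /Lam /M ME => ->.
have w2s2 : (2%:E <= w2s)%E := koksma_ge2 v_abs v_ext a0 a_deg a_aper xi_cf.
have w22 : (2%:E <= w2)%E := mahler_ge2 a0 a_deg a_aper xi_cf.
have notNy (x : \bar R) : (2%:E <= x)%E -> x != -oo%E.
  by apply: contraTneq => ->; rewrite leeNy_eq.
have koksma_bound : ((lam / Lam)%:E * D - 1%:E <= w2s)%E.
  rewrite -[D]adde0; apply: ereal_sup_affine => //; first exact: notNy.
  move=> rho rho_star; rewrite addr0.
  exact: (koksma_ge_star v_abs v_ext a0 a_deg a_aper xi_cf lam1 lamLam lower upper).
have mahler_bound : ((lam / Lam)%:E * (D + 1%:E) - 1%:E <= w2)%E.
  apply: ereal_sup_affine => //; first exact: notNy.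
  move=> rho rho_star.
  exact: (mahler_ge_star a0 a_deg a_aper xi_cf lam1 lamLam lower upper).
split.
- exact: (koksma_le_mahler2 v_abs v_ext a0 a_deg a_aper xi_cf).
- by rewrite ge_max w2s2 muE.
- by move=> /mu1 mu; rewrite ge_max w2s2 /=; move: koksma_bound; rewrite mu mul1e.
- move=> _; rewrite muE; split; first by rewrite ge_max w22.
  move=> /mu1 mu; rewrite ge_max w22 /=; move: mahler_bound.
  by rewrite mu mul1e addeK.
Qed.
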